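(* Let $\Sigma$ be a smooth compact torus and let $F\colon[0,T)\times\Sigma\to\mathbb S^3$ be a maximal smooth solution of the Möbius-invariant Willmore flow (MIWF), $F_t=F(t,\cdot)$, with $T=T_{\max}(F_0)<\infty$ and $\mathcal W(F_0)\leq8\pi$. Assume that for some $c_0>0$ one has $\inf_{0<t<T}\min_{x\in\Sigma}|A_t^0(x)|^2\geq c_0$. Let $\mathbf V_T$ be the weak varifold limit, as $t\nearrow T$, of the integral two-varifolds $\mathbf V_t$ in $\mathbb R^4$ induced by $F_t$ (it exists, is unique and is an integral two-varifold). If $\mathbf V_T\neq0$, then $$F_t(\Sigma)\longrightarrow\operatorname{spt}\mathbf V_T\qquad\text{in Hausdorff distance as }t\nearrow T .$$
   Context: **Flow.** $\mathbb S^3\subset\mathbb R^4$ is the unit sphere with round metric $g_{\mathbb S^3}$. For a smooth immersion $F_t\colon\Sigma\to\mathbb S^3$: $g_t:=F_t^*g_{\mathbb S^3}$, $\mu_t$ is its area measure, and $A_t,A_t^0,H_t$ are the second fundamental form, its trace-free part, and the trace mean-curvature vector of $F_t$ in $\mathbb S^3$; norms are with respect to $g_t$ and $g_{\mathbb S^3}$. $\mathcal W(F_t)=\int_\Sigma(1+\frac14|H_t|^2)\,\mathrm d\mu_t$. The $L^2$-gradient $G_t$ is the normal field with $D\mathcal W(F_t)[\phi]=\int_\Sigma\langle G_t,\phi\rangle\,\mathrm d\mu_t$ for all smooth normal fields $\phi$. A smooth MIWF is a smooth family of umbilic-free immersions satisfying $\partial_tF_t=-|A_t^0|^{-4}G_t$.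 $T_{\max}(F_0)$ is the right endpoint of the maximal interval of existence of the smooth MIWF starting from $F_0$. **Varifolds.** $G_2(\mathbb R^4)=\mathbb R^4\times G(4,2)$ (unoriented two-planes). $\mathbf V_t(\Phi):=\int_\Sigma\Phi(F_t(x),\mathrm dF_t(T_x\Sigma))\,\mathrm d\mu_t(x)$ for $\Phi\in C_c(G_2(\mathbb R^4))$. Weak varifold convergence is convergence against every $\Phi\in C_c(G_2(\mathbb R^4))$. $\lVert V\rVert$ is the weight measure and $\operatorname{spt}V:=\operatorname{spt}\lVert V\rVert$. **Hausdorff distance** of nonempty compact $K,L\subset\mathbb R^4$: $\max\{\sup_{x\in K}\inf_{y\in L}|x-y|,\ \sup_{y\in L}\inf_{x\in K}|x-y|\}$ with the Euclidean norm. *)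

(* Defs.v *)
From HB Require Import structures.
From mathcomp Require Import all_boot all_order all_algebra.
From mathcomp Require Import all_classical all_reals all_analysis.

Set Implicit Arguments.
Unset Strict Implicit.
Unset Printing Implicit Defensive.

Import Order.TTheory GRing.Theory Num.Theory.
Import numFieldNormedType.Exports.

Local Open Scope classical_set_scope.
Local Open Scope ring_scope.

(* [Ck k U f]: all iterated directional derivatives of f of order <= k, in
   arbitrary directions, exist and are continuous on U.  It is meant for open
   U and finite-dimensional V, where this is the usual class C^k. *)
Fixpoint Ck (R : realType) (V W : normedModType R) (k : nat) (U : set V)
    (f : V -> W) : Prop :=
  (forall x, U x -> {for x, continuous f}) /\
  match k with
  | 0%N => True
  | k'.+1 => forall v : V, (forall x, U x -> derivable f x v) /\
                           Ck k' U (fun x => 'D_v f x)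
  end.

(* A map on an arbitrary set is smooth if it extends to a smooth map on an open
   neighbourhood (needed for half-open time intervals). *)
Definition smooth_on (R : realType) (V W : normedModType R) (A : set V)
    (f : V -> W) : Prop :=
  exists U : set V, exists g : V -> W,
    [/\ open U, A `<=` U, forall k, Ck k U g & forall x, A x -> g x = f x].

(* The norm of the library on ['rV_4] is the sup norm, hence [enorm]. *)
Definition dot (R : realType) (u v : 'rV[R]_4) : R :=
  \sum_(i < 4) u 0 i * v 0 i.

Definition enorm (R : realType) (u : 'rV[R]_4) : R := Num.sqrt (dot u u).

(* The torus is R^2/Z^2: a map on it is a Z^2-periodic map on R * R. *)
Definition periodic (R : realType) (T : Type) (f : R * R -> T) : Prop :=
  forall x y, f (x + 1, y) = f (x, y) /\ f (x, y + 1) = f (x, y).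

Definition dir (R : realType) (i : 'I_2) : R * R :=
  if i == 0 then (1, 0) else (0, 1).

Definition partial (R : realType) (i : 'I_2) (f : R * R -> 'rV[R]_4)
    (p : R * R) : 'rV[R]_4 := 'D_(dir R i) f p.

(* Rows are the two coordinate tangent vectors. *)
Definition jac (R : realType) (f : R * R -> 'rV[R]_4) (p : R * R)
    : 'M[R]_(2, 4) := \matrix_(i < 2) partial i f p.

Definition immersionS3 (R : realType) (f : R * R -> 'rV[R]_4) : Prop :=
  [/\ smooth_on setT f, periodic f, forall p, enorm (f p) = 1
    & forall p, row_free (jac f p)].

Definition metric (R : realType) (f : R * R -> 'rV[R]_4) (p : R * R) : 'M[R]_2 :=
  \matrix_(i, j) dot (partial i f p) (partial j f p).

Definition lebesgue2 (R : realType) := (@lebesgue_measure R \x @lebesgue_measure R)%E.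

(* Integral over the torus against the area measure of the induced metric; the
   closed unit square is a fundamental domain up to a null set. *)
Definition intmu (R : realType) (f : R * R -> 'rV[R]_4) (h : R * R -> R) : R :=
  \int[@lebesgue2 R]_(p in `[0, 1] `*` `[0, 1])
    (h p * Num.sqrt (\det (metric f p))).

(* Orthogonal projection of R^4 onto the tangent plane [dF(T_pSigma)], acting on
   row vectors. *)
Definition tanproj (R : realType) (f : R * R -> 'rV[R]_4) (p : R * R) : 'M[R]_4 :=
  (jac f p)^T *m invmx (metric f p) *m jac f p.

(* Orthogonal projection onto the normal line in [T_(f p)S^3], i.e. onto the
   orthogonal complement of the tangent plane and of the position vector. *)
Definition norproj (R : realType) (f : R * R -> 'rV[R]_4) (p : R * R) : 'M[R]_4 :=
  1%:M - tanproj f p - (f p)^T *m f p.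

(* The coefficients [A_ij] are vectors, normal to the surface in S^3. *)
Definition sff (R : realType) (f : R * R -> 'rV[R]_4) (p : R * R) (i j : 'I_2)
    : 'rV[R]_4 := partial i (partial j f) p *m norproj f p.

Definition meancurv (R : realType) (f : R * R -> 'rV[R]_4) (p : R * R)
    : 'rV[R]_4 :=
  \sum_(i < 2) \sum_(j < 2) invmx (metric f p) i j *: sff f p i j.

Definition sff0 (R : realType) (f : R * R -> 'rV[R]_4) (p : R * R) (i j : 'I_2)
    : 'rV[R]_4 := sff f p i j - (metric f p i j / 2) *: meancurv f p.

Definition sff0_sq (R : realType) (f : R * R -> 'rV[R]_4) (p : R * R) : R :=
  \sum_(i < 2) \sum_(j < 2) \sum_(k < 2) \sum_(l < 2)
    invmx (metric f p) i k * invmx (metric f p) j l *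
    dot (sff0 f p i j) (sff0 f p k l).

Definition umbilic_free (R : realType) (f : R * R -> 'rV[R]_4) : Prop :=
  forall p, exists i j, sff0 f p i j != 0.

Definition willmore (R : realType) (f : R * R -> 'rV[R]_4) : R :=
  intmu f (fun p => 1 + 4^-1 * dot (meancurv f p) (meancurv f p)).

Definition normal_field (R : realType) (f phi : R * R -> 'rV[R]_4) : Prop :=
  [/\ smooth_on setT phi, periodic phi
    & forall p, dot (phi p) (f p) = 0 /\
                forall i, dot (phi p) (partial i f p) = 0].

Definition variation (R : realType) (f phi : R * R -> 'rV[R]_4)
    (Phi : R -> R * R -> 'rV[R]_4) : Prop :=
  exists2 d : R, 0 < d &
    [/\ smooth_on [set z : R * (R * R) | - d < z.1 < d]
          (fun z => Phi z.1 z.2),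
        forall e, - d < e < d -> immersionS3 (Phi e),
        forall p, Phi 0 p = f p
      & forall p, is_derive (0 : R) (1 : R) (fun e => Phi e p) (phi p)].

(* [DW(f)[phi]] is read as the derivative of W along an arbitrary smooth curve of
   immersions into S^3 issued from f with velocity [phi]. *)
Definition L2_gradient (R : realType) (f G : R * R -> 'rV[R]_4) : Prop :=
  normal_field f G /\
  forall phi Phi, normal_field f phi -> variation f phi Phi ->
    is_derive (0 : R) (1 : R) (fun e => willmore (Phi e))
      (intmu f (fun p => dot (G p) (phi p))).

(* A smooth MIWF on [0, T[.  The time derivative is written as a right
   derivative so as to include t = 0; for t > 0 the smoothness of F makes it the
   ordinary derivative. *)
Definition miwf (R : realType) (T : R) (F : R -> R * R -> 'rV[R]_4) : Prop :=
  [/\ 0 < T,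
      smooth_on [set z : R * (R * R) | 0 <= z.1 < T] (fun z => F z.1 z.2),
      forall t, 0 <= t < T -> immersionS3 (F t) /\ umbilic_free (F t)
    & forall t, 0 <= t < T -> exists2 G, L2_gradient (F t) G &
        forall p,
          h^-1 *: (F (t + h) p - F t p) @[h --> (0 : R)^'+]
            --> - (sff0_sq (F t) p ^- 2 *: G p)].

Definition Tmax (R : realType) (f : R * R -> 'rV[R]_4) : \bar R :=
  ereal_sup [set T%:E | T in
    [set T : R | exists2 F, miwf T F & forall p, F 0 p = f p]].

(* G(4,2): a plane is encoded by the orthogonal projection onto it. *)
Definition planes (R : realType) : set 'M[R]_4 :=
  [set P | [/\ P^T = P, P *m P = P & \rank P = 2%N]].
Arguments planes : clear implicits.

Definition grass2 (R : realType) : set ('rV[R]_4 * 'M[R]_4) :=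
  [set z | planes R z.2].
Arguments grass2 : clear implicits.

Definition Cc_grass2 (R : realType) (Phi : 'rV[R]_4 * 'M[R]_4 -> R) : Prop :=
  {within grass2 R, continuous Phi} /\
  exists2 K, compact K & forall z, grass2 R z -> ~ K z -> Phi z = 0.

Definition borel_pair (R : realType) :=
  g_sigma_algebraType [set U : set ('rV[R]_4 * 'M[R]_4) | open U].

(* Radon measures on G_2(R^4), viewed as Borel measures on the ambient space
   carried by G_2(R^4). *)
Definition varifold (R : realType) (V : {measure set (borel_pair R) -> \bar R})
    : Prop :=
  V (~` grass2 R) = 0%E /\
  forall K : set ('rV[R]_4 * 'M[R]_4), compact K -> (V K < +oo)%E.

Definition induced_varifold (R : realType) (f : R * R -> 'rV[R]_4)
    (Phi : 'rV[R]_4 * 'M[R]_4 -> R) : R :=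
  intmu f (fun p => Phi (f p, tanproj f p)).

Definition weight (R : realType) (V : {measure set (borel_pair R) -> \bar R})
    (B : set 'rV[R]_4) : \bar R := V [set z | B z.1].

Definition spt (R : realType) (V : {measure set (borel_pair R) -> \bar R})
    : set 'rV[R]_4 :=
  [set x | forall U, open U -> U x -> weight V U != 0%E].

(* Extended-real valued, so that it is infinite when exactly one of the sets is
   empty; on nonempty compact sets it is the usual real number. *)
Definition hausdorff_dist (R : realType) (K L : set 'rV[R]_4) : \bar R :=
  maxe (ereal_sup [set ereal_inf [set (enorm (x - y))%:E | y in L] | x in K])
       (ereal_sup [set ereal_inf [set (enorm (x - y))%:E | x in K] | y in L]).

(* Main.v *)
Require Import Defs.
From mathcomp Require Import all_boot all_order all_algebra.
From mathcomp Require Import all_classical all_reals all_analysis.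
From mathcomp Require Import measurable_realfun ring lra.
Set Implicit Arguments.
Unset Strict Implicit.
Unset Printing Implicit Defensive.
Import Order.TTheory GRing.Theory Num.Theory.
Import numFieldNormedType.Exports.
Local Open Scope classical_set_scope.
Local Open Scope ring_scope.

(** Let [t] be close to [T].  Two things have to be shown: [spt V] is contained
in a small neighbourhood of the surface [F t], and the surface in a small
neighbourhood of [spt V].

Every point of the support is close to the surface.  A bump function at a point
of [spt V] has a positive integral against [V], hence by weak convergence a
positive integral over the surface, which must therefore enter the bump
([spt_approximated]).  The support is closed, and by the same argument it stays
within bounded distance of the unit sphere; it is compact, and finitely many
bumps give the uniform statement [spt_near_flow].

No part of the surface is far from the support ([flow_near_spt]).  A compactly
supported function that vanishes near [spt V] has integral 0 against [V], so
the area of the part of [F t] away from [spt V] tends to 0, and what has to be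
excluded is a tentacle of very small area.  This is Simon's argument for
Hausdorff convergence under a bound on the Willmore energy.  Let [h] be the
mean curvature vector of the surface as a surface in R^4.  The first variation
formula for the field [chi (|x|^2) / (|x|^2 + e) x], centred at a point of the
surface ([divergence_theorem]), and the completion of a square give
[energy_inequality].  The left side of that inequality is at least 1/36 for
small [e], whatever the surface is ([density_bound]).  In every ball of radius
[r] centred on the surface one thus has
  1/36 <= 1/8 * (integral of |h|^2 over the ball) + 4/r^2 * (area in the ball):
a piece of the surface with little area carries curvature.  On the unit sphere
|h|^2 = |H|^2 + 4, so the total integral of |h|^2 is four times the Willmore
energy [W], and summing over the centres of [n] disjoint balls yields
  n/36 <= W/2 + 4/r^2 * (area in the union of the balls)   ([packing_bound]).

The torus is connected and comes close to [spt V].  If it also had a point at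
distance at least [eps] from [spt V], the distance to [spt V] would take on it
[n] evenly spaced values between [eps/2] and [eps], and points with these values
are centres of disjoint balls that stay away from [spt V].  Since the Willmore
energy decreases along the flow ([willmore_nonincreasing]), it is bounded near
[T]; for [n] large this contradicts the last inequality as soon as the area away
from [spt V] is small enough. *)

(** * Integrals over the unit square *)

Section square.
Context {R : realType}.
Implicit Types f g : R * R -> R.

Local Notation square := (`[0, 1] `*` `[0, 1] : set (R * R)).
Local Notation leb2 := (@lebesgue2 R).

(** The product sigma-algebra contains the open sets because the plane has a
countable base, here the squares with rational centres and radii [1 / n]. *)
Lemma open_measurable_plane (U : set (R * R)) : open U -> measurable U.
Proof.
move=> oU.
pose Q (z : rat * rat * nat) : set (R * R) :=
  ball (ratr z.1.1 : R) (z.2.+1%:R^-1) `*` ball (ratr z.1.2 : R) (z.2.+1%:R^-1).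
have -> : U = \bigcup_(z in [set z | Q z `<=` U]) Q z.
  apply/seteqP; split => [[x y] Uxy|p [z] /[apply] //].
  have /nbhs_ballP[e /= e0 eU] := open_nbhs_nbhs (conj oU Uxy).
  have [n] := ltr_add_invr (divr_gt0 e0 (ltr0n R 2)).
  rewrite add0r; set d : R := n.+1%:R^-1 => de.
  have d0 : 0 < d by rewrite invr_gt0.
  have rat_near (a : R) : exists q : rat, ball (ratr q : R) d a.
    have [q] := @rat_in_itvoo R (a - d) (a + d) ltac:(lra).
    rewrite in_itv/= => /andP[qa qb]; exists q.
    by rewrite /ball/= ltr_norml; apply/andP; split; lra.
  have [q1 q1x] := rat_near x; have [q2 q2y] := rat_near y.
  exists (q1, q2, n) => //= -[x' y'] [/= x'q y'q]; apply: eU.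
  split => /=; [move: q1x x'q|move: q2y y'q]; rewrite /ball/= -/d !ltr_norml;
    by move=> /andP[? ?] /andP[? ?]; apply/andP; split; lra.
rewrite bigcup_mkcond; apply: countable_bigcupT_measurable.
  exact: countableP.
by move=> z; case: ifPn => // _; apply: measurableX; exact: measurable_ball.
Qed.

Lemma continuous_measurable_plane f : continuous f -> measurable_fun setT f.
Proof.
move=> /continuousP cf; apply: (measurability _ (RGenOpens.measurableE R)).
move=> _ [_ [a [b ->] <-]]; rewrite setTI.
by apply: open_measurable_plane; exact/cf/interval_open.
Qed.

Lemma measurable_square : measurable square.
Proof. exact: measurableX. Qed.

Lemma lebesgue2_square_lty : (leb2 square < +oo)%E.
Proof.
rewrite /lebesgue2 product_measure1E//= !lebesgue_measure_itv/= lte_fin ltr01.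
by rewrite -EFinB -EFinM ltry.
Qed.

Lemma continuous_integrable_square f : continuous f ->
  leb2.-integrable square (EFin \o f).
Proof.
move=> cf; apply: measurable_bounded_integrable.
- exact: measurable_square.
- exact: lebesgue2_square_lty.
- by apply: measurable_funTS; exact: continuous_measurable_plane.
have csq : compact square by apply: compact_setX; exact: segment_compact.
have : compact (f @` square).
  apply: continuous_compact => //; exact: continuous_subspaceT.
move=> /compact_bounded; rewrite /bounded_set.
move=> [M [Mr MP]]; exists M; split => // x Mx p sp; apply: MP => //.
Qed.

Lemma continuous_sum n (f : 'I_n -> R * R -> R) : (forall i, continuous (f i)) ->
  continuous (fun p => \sum_(i < n) f i p).
Proof.
by move=> cf; apply: continuous_big => [|i _]; [exact: add_continuous|exact: cf].
Qed.

Definition square_integral f : R := \int[leb2]_(p in square) f p.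

Lemma square_integral_le f g : continuous f -> continuous g ->
  (forall p, f p <= g p) -> square_integral f <= square_integral g.
Proof.
move=> cf cg fg; apply: le_Rintegral; [exact: measurable_square|..] => //.
- exact: continuous_integrable_square.
- exact: continuous_integrable_square.
Qed.

Lemma square_integralD f g : continuous f -> continuous g ->
  square_integral (fun p => f p + g p) = square_integral f + square_integral g.
Proof.
move=> cf cg; rewrite /square_integral RintegralD//; [exact: measurable_square|..].
- exact: continuous_integrable_square.
- exact: continuous_integrable_square.
Qed.

Lemma square_integralZ (c : R) f : continuous f -> square_integral (fun p => c * f p) =
  c * square_integral f.
Proof.
move=> cf; rewrite /square_integral RintegralZl//; first exact: measurable_square.
exact: continuous_integrable_square.
Qed.

Lemma square_integral_sum n (f : 'I_n -> R * R -> R) : (forall i, continuous (f i)) ->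
  square_integral (fun p => \sum_(i < n) f i p) = \sum_(i < n) square_integral (f i).
Proof.
elim: n f => [|n IH] f cf.
  rewrite big_ord0 /square_integral -[RHS](mul0r (square_integral (fun=> 0)))
    -square_integralZ//.
    by apply: eq_Rintegral => p _; rewrite big_ord0 mul0r.
  by move=> p; exact: cvg_cst.
rewrite big_ord_recr/= -IH// -square_integralD//.
  by apply: eq_Rintegral => p _; rewrite big_ord_recr.
apply: continuous_sum => i; exact: cf.
Qed.

Lemma square_integral_fin f : continuous f ->
  (square_integral f)%:E = (\int[leb2]_(p in square) (f p)%:E)%E.
Proof.
move=> cf; rewrite /square_integral/Rintegral fineK//.
apply: integrable_fin_num; [exact: measurable_square|].
exact: continuous_integrable_square.
Qed.

Let patch_squareE f x y : ((EFin \o f) \_ square)%E (x, y) =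
  (((fun a => ((fun b => (f (a, b))%:E) \_ `[0%R, 1%R]) y) \_ `[0%R, 1%R]) x)%E.
Proof. by rewrite /patch in_setX/=; do 2 case: (_ \in _). Qed.

Let patch_integrable f : continuous f ->
  (@lebesgue_measure R \x @lebesgue_measure R)%E.-integrable setT
    ((EFin \o f) \_ square)%E.
Proof.
move=> cf; have := continuous_integrable_square cf.
exact: (@integrable_mkcond _ _ _ (product_measure1 lebesgue_measure lebesgue_measure)
  _ (EFin \o f) measurable_square).1.
Qed.

Lemma square_integral_fubini12 f : continuous f -> (square_integral f)%:E =
  (\int[lebesgue_measure]_(x in `[0%R, 1%R])
     \int[lebesgue_measure]_(y in `[0%R, 1%R]) (f (x, y))%:E)%E.
Proof.
move=> cf; rewrite square_integral_fin// integral_mkcond/=.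
rewrite -(integral12_prod_meas1 (patch_integrable cf)) [RHS]integral_mkcond/=.
apply: eq_integral => x _; rewrite /fubini_F patchE.
under eq_integral do rewrite patch_squareE.
case: ifPn => x01.
  by rewrite [RHS]integral_mkcond; apply: eq_integral => y _; rewrite patchE x01.
by apply: integral0_eq => y _; rewrite patchE (negPf x01).
Qed.

Lemma square_integral_fubini21 f : continuous f -> (square_integral f)%:E =
  (\int[lebesgue_measure]_(y in `[0%R, 1%R])
     \int[lebesgue_measure]_(x in `[0%R, 1%R]) (f (x, y))%:E)%E.
Proof.
move=> cf; rewrite square_integral_fin// integral_mkcond/=.
rewrite -(integral21_prod_meas1 (patch_integrable cf)) [RHS]integral_mkcond/=.
apply: eq_integral => y _; rewrite /fubini_G patchE.
under eq_integral do rewrite patch_squareE.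
case: ifPn => y01.
  rewrite [RHS]integral_mkcond; apply: eq_integral => x _.
  by rewrite !patchE y01.
by apply: integral0_eq => x _; rewrite !patchE (negPf y01); case: ifP.
Qed.

Lemma is_derive_slice1 f x y l :
  is_derive (x, y) ((1, 0) : R * R) f l -> is_derive x (1 : R) (fun a => f (a, y)) l.
Proof.
have E : (fun h : R => h^-1 *: (f (h *: ((1, 0) : R * R) + (x, y)) - f (x, y))) =
         (fun h : R => h^-1 *: (f (h *: 1 + x, y) - f (x, y))).
  apply/funext => h.
  have -> : h *: ((1, 0) : R * R) + (x, y) = (h *: 1 + x, h *: 0 + y) by [].
  by rewrite scaler0 add0r.
move=> [d e]; split.
  by move: d; rewrite /derivable/= E.
by move: e; rewrite /derive/= E.
Qed.

Lemma is_derive_slice2 f x y l :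
  is_derive (x, y) ((0, 1) : R * R) f l -> is_derive y (1 : R) (fun b => f (x, b)) l.
Proof.
have E : (fun h : R => h^-1 *: (f (h *: ((0, 1) : R * R) + (x, y)) - f (x, y))) =
         (fun h : R => h^-1 *: (f (x, h *: 1 + y) - f (x, y))).
  apply/funext => h.
  have -> : h *: ((0, 1) : R * R) + (x, y) = (h *: 0 + x, h *: 1 + y) by [].
  by rewrite scaler0 add0r.
move=> [d e]; split.
  by move: d; rewrite /derivable/= E.
by move: e; rewrite /derive/= E.
Qed.

Lemma continuous_slice1 f y : continuous f -> continuous (fun x => f (x, y)).
Proof.
move=> cf x; apply: (@continuous_comp _ _ _ (fun x => (x, y)) f); last exact: cf.
by apply: (@cvg_pair _ _ _ (nbhs x) (nbhs x) (nbhs y) _ _ _ id (cst y));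
  [exact: cvg_id|exact: cvg_cst].
Qed.

Lemma continuous_slice2 f x : continuous f -> continuous (fun y => f (x, y)).
Proof.
move=> cf y; apply: (@continuous_comp _ _ _ (fun y => (x, y)) f); last exact: cf.
by apply: (@cvg_pair _ _ _ (nbhs y) (nbhs x) (nbhs y) _ _ _ (cst x) id);
  [exact: cvg_cst|exact: cvg_id].
Qed.

Lemma integral_derive_periodic (u du : R -> R) : continuous du ->
  (forall x, is_derive x (1 : R) u (du x)) -> u 0 = u 1 ->
  (\int[lebesgue_measure]_(x in `[0%R, 1%R]) (du x)%:E = 0)%E.
Proof.
move=> cdu udu u01.
have cu : continuous u.
  by move=> x; apply/differentiable_continuous/derivable1_diffP; have [] := udu x.
rewrite (@continuous_FTC2 _ du u)//.
- by rewrite u01 subee.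
- exact: continuous_subspaceT.
- split.
  + by move=> x _; have [] := udu x.
  + by apply: cvg_at_right_filter; exact: cu.
  + by apply: cvg_at_left_filter; exact: cu.
- by move=> x _; rewrite derive1E; exact: derive_val.
Qed.

(** A torus has no boundary: on each horizontal line the fundamental theorem of
calculus leaves two boundary terms, and periodicity cancels them. *)
Lemma square_integral_derive1 f df : continuous df ->
  (forall p, is_derive p ((1, 0) : R * R) f (df p)) ->
  (forall y, f (0, y) = f (1, y)) -> square_integral df = 0.
Proof.
move=> cdf fdf f01; apply: EFin_inj; rewrite square_integral_fubini21//.
apply: integral0_eq => y _; apply: (@integral_derive_periodic (fun x => f (x, y))) => //.
- exact: continuous_slice1.
- by move=> x; exact: is_derive_slice1.
Qed.

Lemma square_integral_derive2 f df : continuous df ->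
  (forall p, is_derive p ((0, 1) : R * R) f (df p)) ->
  (forall x, f (x, 0) = f (x, 1)) -> square_integral df = 0.
Proof.
move=> cdf fdf f01; apply: EFin_inj; rewrite square_integral_fubini12//.
apply: integral0_eq => x _; apply: (@integral_derive_periodic (fun y => f (x, y))) => //.
- exact: continuous_slice2.
- by move=> y; exact: is_derive_slice2.
Qed.

(** A parallelogram with two vertical sides.  Such a parallelogram, unlike a
rectangle with sides parallel to the axes, fits into an arbitrary ellipse
with a fixed proportion of its area. *)
Definition shear (p : R * R) (k al be : R) : set (R * R) :=
  [set z | `|z.1 - p.1| <= al /\ `|z.2 - p.2 + k * (z.1 - p.1)| <= be].

Lemma measurable_shear p k al be : measurable (shear p k al be).
Proof.
pose u (z : R * R) := z.1 - p.1.
pose v (z : R * R) := z.2 - p.2 + k * (z.1 - p.1).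
have cu : continuous u.
  by move=> z; apply: cvgB; [exact: cvg_fst|exact: cvg_cst].
have cv : continuous v.
  move=> z; apply: cvgD; first by apply: cvgB; [exact: cvg_snd|exact: cvg_cst].
  by apply: cvgMr; exact: cu.
have -> : shear p k al be = u @^-1` `[- al, al] `&` v @^-1` `[- be, be].
  by apply/seteqP; split => z; rewrite /shear/= !in_itv/= !ler_norml.
apply: measurableI; rewrite -[X in measurable X]setTI.
  by apply: (continuous_measurable_plane cu) => //; exact: measurable_itv.
by apply: (continuous_measurable_plane cv) => //; exact: measurable_itv.
Qed.

Lemma lebesgue2_shear p k al be : 0 <= al -> 0 <= be ->
  leb2 (shear p k al be) = (4 * al * be)%:E.
Proof.
move=> al0 be0.
transitivity (\int[@lebesgue_measure R]_x
    ((fun=> (2 * be)%:E) \_ `[(p.1 - al)%R, (p.1 + al)%R]) x)%E.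
  apply: eq_integral => x _; rewrite patchE mem_setE in_itv/= -ler_distlC distrC.
  case: ifPn => xp.
    have -> : xsection (shear p k al be) x =
        `[p.2 - k * (x - p.1) - be, p.2 - k * (x - p.1) + be]%classic.
      apply/seteqP; split => y; rewrite /xsection/= inE /shear/= in_itv/=.
        by rewrite [in X in _ /\ X]ler_norml => -[_ /andP[? ?]]; apply/andP; split; lra.
      by move=> /andP[? ?]; split => //; rewrite ler_norml; apply/andP; split; lra.
    rewrite lebesgue_measure_itv/= lte_fin; case: ifPn => h.
      by rewrite -EFinB; congr EFin; lra.
    by congr EFin; move: h; rewrite -leNgt => h; lra.
  have -> : xsection (shear p k al be) x = set0.
    apply/seteqP; split => y //; rewrite /xsection/= inE /shear/= => -[h _].
    by rewrite h in xp.
  by rewrite measure0.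
rewrite -integral_mkcond integral_cst//= lebesgue_measure_itv/= lte_fin.
case: ifPn => h.
  by rewrite -EFinB -EFinM; congr EFin; lra.
have -> : al = 0 by move: h; rewrite -leNgt => h; lra.
by rewrite mule0 mulr0 mul0r.
Qed.

(** Chebyshev's inequality, in the form used for the lower density bound. *)
Lemma square_integral_ge_shear f c p k al be : continuous f -> (forall z, 0 <= f z) ->
  0 <= al -> 0 <= be -> 0 <= c -> shear p k al be `<=` square ->
  (forall z, shear p k al be z -> c <= f z) -> c * (4 * al * be) <= square_integral f.
Proof.
move=> cf f0 al0 be0 c0 Ssq cS.
rewrite -lee_fin EFinM -(lebesgue2_shear p k al0 be0) square_integral_fin//.
have mS := measurable_shear p k al be.
rewrite -(integral_cst leb2 mS c%:E).
have mf (D : set (R * R)) : measurable_fun D f.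
  by apply: measurable_funTS; exact: continuous_measurable_plane.
apply: (@le_trans _ _ (\int[leb2]_(x in shear p k al be) (f x)%:E)%E).
  apply: ge0_le_integral => //.
  exact: (measurable_EFinP _ _).2 (mf _).
apply: ge0_subset_integral => //;
  [exact: measurable_square|exact: (measurable_EFinP _ _).2 (mf _)|].
by move=> z _; rewrite lee_fin.
Qed.

End square.

(** * Directional derivatives and functions of two variables *)

Section dot.
Context {R : realType}.
Implicit Types u v w : 'rV[R]_4.

Lemma dotE u v : dot u v = (u *m v^T) 0 0.
Proof. by rewrite mxE; apply: eq_bigr => i _; rewrite mxE. Qed.

Lemma dotC u v : dot u v = dot v u.
Proof. by apply: eq_bigr => i _; rewrite mulrC. Qed.

Lemma dotDl u v w : dot (u + v) w = dot u w + dot v w.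
Proof. by rewrite -big_split/=; apply: eq_bigr => i _; rewrite mxE mulrDl. Qed.

Lemma dotZl (k : R) u v : dot (k *: u) v = k * dot u v.
Proof. by rewrite mulr_sumr; apply: eq_bigr => i _; rewrite mxE mulrA. Qed.

Lemma dotNl u v : dot (- u) v = - dot u v.
Proof. by rewrite -scaleN1r dotZl mulN1r. Qed.

Lemma dotBl u v w : dot (u - v) w = dot u w - dot v w.
Proof. by rewrite dotDl dotNl. Qed.

Lemma dot0l u : dot 0 u = 0.
Proof. by rewrite -(scale0r 0) dotZl mul0r. Qed.

Lemma dotDr u v w : dot w (u + v) = dot w u + dot w v.
Proof. by rewrite dotC dotDl !(dotC w). Qed.

Lemma dotZr (k : R) u v : dot v (k *: u) = k * dot v u.
Proof. by rewrite dotC dotZl (dotC v). Qed.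

Lemma dotNr u v : dot v (- u) = - dot v u.
Proof. by rewrite dotC dotNl (dotC v). Qed.

Lemma dotBr u v w : dot w (u - v) = dot w u - dot w v.
Proof. by rewrite dotDr dotNr. Qed.

Definition dot_lin := (dotDl, dotDr, dotBl, dotBr, dotNl, dotNr, dotZl, dotZr).

Lemma dot_ge0 u : 0 <= dot u u.
Proof. by apply: sumr_ge0 => i _; rewrite -expr2 sqr_ge0. Qed.

Lemma dot_eq0 u : (dot u u == 0) = (u == 0).
Proof.
apply/eqP/eqP => [|->]; last exact: dot0l.
move=> /eqP; rewrite psumr_eq0; last by move=> i _; rewrite -expr2 sqr_ge0.
move=> /allP h; apply/rowP => i; rewrite mxE; apply/eqP.
by have := h i (mem_index_enum _); rewrite -expr2 sqrf_eq0.
Qed.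

Lemma sqr_norm_le_dot u : `|u| ^+ 2 <= dot u u.
Proof.
have [->|u0] := eqVneq u 0; first by rewrite normr0 expr0n dot0l.
have [] := @mx_norm_neq0 R 1 4 u.
  by rewrite -[mx_norm u]/(`|u|) normr_eq0.
move=> [i j]; rewrite -[mx_norm u]/(`|u|) => ->/=.
rewrite ord1 real_normK ?num_real// expr2 /dot (bigD1 j)//= lerDl.
by apply: sumr_ge0 => k _; rewrite -expr2 sqr_ge0.
Qed.

Lemma norm_coord_le u i : `|u 0 i| <= `|u|.
Proof.
rewrite [leRHS]/Num.Def.normr/= mx_normrE.
exact: (le_bigmax _ (fun ij : 'I_1 * 'I_4 => `|u ij.1 ij.2|) (0, i)).
Qed.

Lemma dot_le_sqr_norm u : dot u u <= 4 * `|u| ^+ 2.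
Proof.
have -> : 4 * `|u| ^+ 2 = \sum_(i < 4) `|u| ^+ 2.
  by rewrite sumr_const card_ord mulr_natl.
apply: ler_sum => i _; rewrite -expr2 -(real_normK (num_real (u 0 i))).
by rewrite lerXn2r ?nnegrE// norm_coord_le.
Qed.

Lemma norm_le_enorm u : `|u| <= enorm u.
Proof.
rewrite /enorm -(ger0_norm (normr_ge0 u)) -sqrtr_sqr.
by rewrite ler_wsqrtr// sqr_norm_le_dot.
Qed.

Lemma enorm_le_norm u : enorm u <= 2 * `|u|.
Proof.
rewrite /enorm -(ger0_norm (_ : 0 <= 2 * `|u|)) ?mulr_ge0// -sqrtr_sqr.
by rewrite ler_wsqrtr// exprMn (le_trans (dot_le_sqr_norm u))// -natrX.
Qed.
End dot.

Section directional.
Context {R : realType} {V : normedModType R}.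
Implicit Types (f g : V -> R) (p v : V).

Lemma is_derive_mul f g p v a b : is_derive p v f a -> is_derive p v g b ->
  is_derive p v (fun x => f x * g x) (a * g p + f p * b).
Proof.
move=> fa gb; apply: (is_derive_eq (is_deriveM fa gb)).
by rewrite addrC; congr (_ + _); rewrite [LHS]mulrC.
Qed.

Lemma is_derive_add f g p v a b : is_derive p v f a -> is_derive p v g b ->
  is_derive p v (fun x => f x + g x) (a + b).
Proof. by move=> fa gb; exact: (is_deriveD fa gb). Qed.

Lemma is_derive_sub f g p v a b : is_derive p v f a -> is_derive p v g b ->
  is_derive p v (fun x => f x - g x) (a - b).
Proof. by move=> fa gb; exact: (is_deriveB fa gb). Qed.

Lemma is_derive_bigsum n (h : 'I_n -> V -> R) p v (dh : 'I_n -> R) :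
  (forall i, is_derive p v (h i) (dh i)) ->
  is_derive p v (fun x => \sum_(i < n) h i x) (\sum_(i < n) dh i).
Proof.
move=> hh; have -> : (fun x => \sum_(i < n) h i x) = \sum_(i < n) h i.
  by apply/funext => x; rewrite fct_sumE.
exact: is_derive_sum.
Qed.

(** Reduces directional derivatives to derivatives in one real variable.  It
gives a chain rule that asks only for directional derivatives, not for total
differentiability of the inner function. *)
Lemma is_derive_line (W : normedModType R) (f : V -> W) p v l :
  is_derive p v f l <-> is_derive (0 : R) (1 : R) (fun h => f (h *: v + p)) l.
Proof.
have E : (fun h : R => h^-1 *: (f (h *: v + p) - f p)) =
   (fun h : R => h^-1 *: (f ((h *: (1 : R) + 0 : R) *: v + p) - f ((0 : R) *: v + p))).
  by apply/funext => h; rewrite addr0 scale0r add0r [h *: 1]mulr1.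
split=> -[d e]; split; first by move: d; rewrite /derivable/= E.
- by move: e; rewrite /derive/= E.
- by move: d; rewrite /derivable/= -E.
- by move: e; rewrite /derive/= -E.
Qed.

Lemma is_derive_comp (phi : R -> R) f p v dphi df :
  is_derive (f p) (1 : R) phi dphi -> is_derive p v f df ->
  is_derive p v (fun x => phi (f x)) (dphi * df).
Proof.
move=> hphi /is_derive_line hf; apply/is_derive_line.
apply: (@is_derive1_comp _ phi (fun h => f (h *: v + p))) => //.
by rewrite scale0r add0r.
Qed.

Lemma is_derive_coord (h : V -> 'rV[R]_4) p v dh i :
  is_derive p v h dh -> is_derive p v (fun x => h x 0 i) (dh 0 i).
Proof.
move=> [hd <-]; apply: DeriveDef; first by have [+ _] := derivable_mxP h p v; exact.
by rewrite derive_mx// mxE.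
Qed.

Lemma is_derive_dot (f g : V -> 'rV[R]_4) p v df dg :
  is_derive p v f df -> is_derive p v g dg ->
  is_derive p v (fun x => dot (f x) (g x)) (dot df (g p) + dot (f p) dg).
Proof.
move=> hf hg; rewrite /dot -big_split/=; apply: is_derive_bigsum => i.
by apply: is_derive_mul; exact: is_derive_coord.
Qed.
End directional.

Section onevar.
Context {R : realType}.
Implicit Types (u du : R -> R).

Lemma is_derive_translate u t l :
  is_derive (0 : R) (1 : R) (fun e => u (t + e)) l -> is_derive t (1 : R) u l.
Proof.
move=> H; apply/is_derive_line.
suff -> : (fun h : R => u (h *: 1 + t)) = (fun e => u (t + e)) by [].
by apply/funext => h; rewrite [h *: 1]mulr1 addrC.
Qed.

Lemma is_derive_continuous u du : (forall x, is_derive x (1 : R) u (du x)) ->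
  continuous u.
Proof.
move=> h x; apply/differentiable_continuous/derivable1_diffP.
by have [] := h x.
Qed.

(** The absolute values cover increments [h] of either sign. *)
Lemma mean_value u du a h : (forall x, is_derive x (1 : R) u (du x)) ->
  exists c, `|c - a| <= `|h| /\ u (a + h) - u a = du c * h.
Proof.
move=> udu; have cu := is_derive_continuous udu.
have [h0|h0|->] := ltgtP h 0.
- have [//|c|c] := @MVT _ u du (a + h) a _ (fun x _ => udu x).
  + lra.
  + exact: continuous_subspaceT.
  rewrite in_itv/= => /andP[? ?] e; exists c; split; last first.
    by rewrite -[LHS]opprB e; ring.
  by rewrite !ler0_norm; lra.
- have [//|c|c] := @MVT _ u du a (a + h) _ (fun x _ => udu x).
  + lra.
  + exact: continuous_subspaceT.
  rewrite in_itv/= => /andP[? ?] e; exists c; split; last by rewrite e; ring.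
  by rewrite !ger0_norm; lra.
- by exists a; rewrite addr0 !subrr mulr0 normr0.
Qed.

(** A way to differentiate functions given by cases: the quadratic error bound
can be checked in each case without a limit. *)
Lemma is_derive_quadratic u x c k : 0 <= k ->
  (forall h, `|u (x + h) - u x - c * h| <= k * h ^+ 2) -> is_derive x (1 : R) u c.
Proof.
move=> k0 uc.
suff H : h^-1 *: (u (h *: 1 + x) - u x) @[h --> 0^'] --> c.
  by apply: DeriveDef; [apply/cvg_ex; exists c|exact/cvg_lim].
apply/cvgrPdist_le => /= e e0; near=> h.
have h0 : h != 0 by near: h; exact: nbhs_dnbhs_neq.
have hn : 0 < `|h| by rewrite normr_gt0.
rewrite [h *: 1]mulr1 (addrC h) -normrN opprB.
have -> : h^-1 *: (u (x + h) - u x) - c = h^-1 * (u (x + h) - u x - c * h).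
  by rewrite [in RHS]mulrBr [in X in _ = _ - X]mulrCA mulVf ?mulr1.
rewrite normrM normfV mulrC ler_pdivrMr// (le_trans (uc h))//.
rewrite -(real_normK (num_real h)) expr2 mulrA ler_wpM2r//.
have : `|h| <= e / (k + 1).
  near: h; apply: dnbhs0_le; rewrite divr_gt0//; lra.
rewrite ler_pdivlMr; last lra.
by move=> ?; rewrite mulrC (le_trans _ (_ : `|h| * (k + 1) <= _))// ler_wpM2l//; lra.
Unshelve. all: by end_near. Qed.

Lemma continuous_pos (T : topologicalType) (s : T -> R) : continuous s ->
  continuous (fun p => Num.max 0 (s p)).
Proof.
move=> cs; have -> : (fun p => Num.max 0 (s p)) = (fun p => (s p + `|s p|) / 2).
  by apply/funext => p; rewrite maxr_absE add0r sub0r normrN.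
by move=> p; apply: cvgMl; apply: cvgD; [exact: cs|apply: cvg_norm; exact: cs].
Qed.

(** The square makes the truncation continuously differentiable, as the first
variation formula requires of the cutoff. *)
Definition pos2 (y : R) := Num.max 0 y ^+ 2.

Lemma is_derive_pos2 (y : R) : is_derive y (1 : R) pos2 (2 * Num.max 0 y).
Proof.
apply: (@is_derive_quadratic _ _ _ 1) => // h; rewrite /pos2 mul1r ler_norml.
have [y0|y0] := lerP 0 y; have [yh|yh] := lerP 0 (y + h); apply/andP; split;
  rewrite ?expr2; nra.
Qed.

End onevar.

Section plane.
Context {R : realType}.
Local Notation e1 := ((1, 0) : R * R).
Local Notation e2 := ((0, 1) : R * R).

Lemma continuous_near_box (G : R * R -> R) p e : {for p, continuous G} -> 0 < e ->
  exists2 d, 0 < d &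
    forall q, `|q.1 - p.1| <= d -> `|q.2 - p.2| <= d -> `|G q - G p| <= e.
Proof.
move=> + e0 => /cvgrPdist_le /(_ _ e0) /nbhs_ballP[d /= d0 dG].
exists (d / 2); first by rewrite divr_gt0.
by move=> q q1 q2; rewrite distrC; apply: dG; split => /=; rewrite /ball/= distrC; lra.
Qed.

Section taylor.
Variables (g g1 g2 : R * R -> R).
Hypothesis d1 : forall p, is_derive p e1 g (g1 p).
Hypothesis d2 : forall p, is_derive p e2 g (g2 p).

Let mv1 x y h : exists c, `|c - x| <= `|h| /\ g (x + h, y) - g (x, y) = g1 (c, y) * h.
Proof.
by apply: (@mean_value _ (fun x => g (x, y)) (fun x => g1 (x, y))) => z;
  exact: is_derive_slice1.
Qed.

Let mv2 x y h : exists c, `|c - y| <= `|h| /\ g (x, y + h) - g (x, y) = g2 (x, c) * h.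
Proof.
by apply: (@mean_value _ (fun y => g (x, y)) (fun y => g2 (x, y))) => z;
  exact: is_derive_slice2.
Qed.

(** Differentiability from continuous partial derivatives, by the mean value
theorem along the two sides of a rectangle. *)
Lemma first_order_expansion p : {for p, continuous g1} -> {for p, continuous g2} ->
  forall eta, 0 < eta -> exists2 d, 0 < d & forall h k, `|h| <= d -> `|k| <= d ->
    `|g (p.1 + h, p.2 + k) - g p - (h * g1 p + k * g2 p)| <= eta * (`|h| + `|k|).
Proof.
move=> c1 c2 eta eta0.
have [a a0 Ha] := continuous_near_box c1 eta0;
  have [b b0 Hb] := continuous_near_box c2 eta0.
exists (Num.min a b); first by rewrite lt_min a0 b0.
move=> h k; rewrite !le_min => /andP[ha hb] /andP[ka kb].
have [x [xh ex]] := mv1 p.1 (p.2 + k) h.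
have [y [yk ey]] := mv2 p.1 p.2 k.
have -> : g (p.1 + h, p.2 + k) - g p - (h * g1 p + k * g2 p) =
    h * (g1 (x, p.2 + k) - g1 p) + k * (g2 (p.1, y) - g2 p).
  have -> : g p = g (p.1, p.2) by rewrite -surjective_pairing.
  rewrite -[g (_ + _, _)](subrK (g (p.1, p.2 + k))) ex.
  by rewrite -(subrK (g (p.1, p.2)) (g (_, _ + _))) ey; ring.
rewrite (le_trans (ler_normD _ _))// [leRHS]mulrDr !normrM.
apply: lerD; rewrite mulrC; apply: ler_wpM2r => //.
- by apply: Ha => /=; [lra|rewrite addrAC subrr add0r].
- by apply: Hb => /=; [rewrite subrr normr0; exact: ltW|lra].
Qed.
End taylor.

(** Symmetry of second derivatives.  The second difference over a small square
equals, by two applications of the mean value theorem in either order, both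
[g12] and [g21] at some points of the square times its area. *)
Lemma mixed_partials (g g1 g2 g12 g21 : R * R -> R) :
  (forall p, is_derive p e1 g (g1 p)) -> (forall p, is_derive p e2 g (g2 p)) ->
  (forall p, is_derive p e2 g1 (g12 p)) -> (forall p, is_derive p e1 g2 (g21 p)) ->
  continuous g12 -> continuous g21 -> g12 =1 g21.
Proof.
move=> d1 d2 d12 d21 c12 c21 [a b].
apply/eqP; rewrite -subr_eq0 -normr_le0; apply/ler_addgt0Pr => e e0; rewrite add0r.
have e20 : 0 < e / 2 by rewrite divr_gt0.
have [r r0 Hr] := continuous_near_box (c12 (a, b)) e20;
  have [s s0 Hs] := continuous_near_box (c21 (a, b)) e20.
pose h := Num.min r s.
have h0 : 0 < h by rewrite lt_min r0 s0.
have [hr hs] : h <= r /\ h <= s by split; rewrite ge_min lexx ?orbT.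
have nh : `|h| = h by rewrite gtr0_norm.
have [x [xa ex]] := @mean_value _ (fun x => g (x, b + h) - g (x, b))
  (fun x => g1 (x, b + h) - g1 (x, b)) a h
  (fun z => is_derive_sub (is_derive_slice1 (d1 _)) (is_derive_slice1 (d1 _))).
have [y [yb ey]] := @mean_value _ (fun y => g1 (x, y)) (fun y => g12 (x, y)) b h
  (fun z => is_derive_slice2 (d12 _)).
have [y' [yb' ey']] := @mean_value _ (fun y => g (a + h, y) - g (a, y))
  (fun y => g2 (a + h, y) - g2 (a, y)) b h
  (fun z => is_derive_sub (is_derive_slice2 (d2 _)) (is_derive_slice2 (d2 _))).
have [x' [xa' ex']] := @mean_value _ (fun x => g2 (x, y')) (fun x => g21 (x, y')) a h
  (fun z => is_derive_slice1 (d21 _)).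
have E : g12 (x, y) = g21 (x', y').
  have hh : h * h != 0 by rewrite mulf_neq0// gt_eqF.
  apply: (mulIf hh); rewrite !mulrA -ey -ex' -ex -ey'; ring.
have A1 := Hr (x, y) ltac:(simpl; lra) ltac:(simpl; lra).
have A2 := Hs (x', y') ltac:(simpl; lra) ltac:(simpl; lra).
have -> : g12 (a, b) - g21 (a, b) = (g21 (x', y') - g21 (a, b)) - (g12 (x, y) - g12 (a, b)).
  by rewrite E; ring.
by rewrite (le_trans (ler_normB _ _))//; lra.
Qed.
End plane.

(** * Functions with continuous partial derivatives *)

Section cauchy_schwarz.
Context {R : realType}.
Lemma dot_cauchy_schwarz (u v : 'rV[R]_4) : dot u v ^+ 2 <= dot u u * dot v v.
Proof.
have [->|v0] := eqVneq v 0; first by rewrite dotC !dot0l expr0n mulr0.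
have vv : 0 < dot v v by rewrite lt_def dot_eq0 v0 dot_ge0.
have := dot_ge0 (dot v v *: u - dot u v *: v).
rewrite !dot_lin (dotC v u) => h.
have : 0 <= dot v v * (dot u u * dot v v - dot u v ^+ 2).
  by apply: le_trans h _; rewrite le_eqVlt; apply/orP; left; apply/eqP; ring.
by rewrite pmulr_rge0// subr_ge0.
Qed.
End cauchy_schwarz.

Section continuity_real.
Context {R : realType} {T : topologicalType}.
Implicit Types g h : T -> R.

Lemma continuous_mul g h : continuous g -> continuous h ->
  continuous (fun p => g p * h p).
Proof. by move=> cg ch p; apply: (@cvgM _ _ (nbhs p)); [exact: cg|exact: ch]. Qed.

Lemma continuous_add g h : continuous g -> continuous h ->
  continuous (fun p => g p + h p).
Proof. by move=> cg ch p; apply: (@cvgD _ _ _ (nbhs p)); [exact: cg|exact: ch]. Qed.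

Lemma continuous_sub g h : continuous g -> continuous h ->
  continuous (fun p => g p - h p).
Proof. by move=> cg ch p; apply: (@cvgB _ _ _ (nbhs p)); [exact: cg|exact: ch]. Qed.

Lemma continuous_const (c : R) : continuous (fun _ : T => c).
Proof. by move=> p; exact: cvg_cst. Qed.
End continuity_real.

Section grad.
Context {R : realType}.
Implicit Types g h : R * R -> R.
Local Notation e1 := ((1, 0) : R * R).
Local Notation e2 := ((0, 1) : R * R).

(** Continuous partial derivatives are all that integration by parts on the
square needs, and this class is stable under the operations below. *)
Definition has_grad g g1 g2 := [/\ continuous g, continuous g1, continuous g2,
  (forall p, is_derive p e1 g (g1 p)) & (forall p, is_derive p e2 g (g2 p))].

Lemma continuous_inv g : continuous g -> (forall p, g p != 0) ->
  continuous (fun p => (g p)^-1).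
Proof. by move=> cg g0 p; apply: cvgV => //; exact: cg. Qed.

Lemma has_grad_mul g g1 g2 h h1 h2 : has_grad g g1 g2 -> has_grad h h1 h2 ->
  has_grad (fun p => g p * h p) (fun p => g1 p * h p + g p * h1 p)
           (fun p => g2 p * h p + g p * h2 p).
Proof.
move=> [cg cg1 cg2 dg1 dg2] [ch ch1 ch2 dh1 dh2]; split.
- exact: continuous_mul.
- by apply: continuous_add; apply: continuous_mul.
- by apply: continuous_add; apply: continuous_mul.
- by move=> p; exact: is_derive_mul.
- by move=> p; exact: is_derive_mul.
Qed.

Lemma has_grad_sub g g1 g2 h h1 h2 : has_grad g g1 g2 -> has_grad h h1 h2 ->
  has_grad (fun p => g p - h p) (fun p => g1 p - h1 p) (fun p => g2 p - h2 p).
Proof.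
move=> [cg cg1 cg2 dg1 dg2] [ch ch1 ch2 dh1 dh2]; split;
  try exact: continuous_sub; by move=> p; exact: is_derive_sub.
Qed.

Lemma has_grad_comp (phi dphi : R -> R) g g1 g2 : has_grad g g1 g2 ->
  (forall p, is_derive (g p) (1 : R) phi (dphi (g p))) ->
  continuous (fun p => dphi (g p)) ->
  has_grad (fun p => phi (g p)) (fun p => dphi (g p) * g1 p)
           (fun p => dphi (g p) * g2 p).
Proof.
move=> [cg cg1 cg2 dg1 dg2] dp cd; split.
- move=> p; apply: (@continuous_comp _ _ _ g phi); first exact: cg.
  by apply/differentiable_continuous/derivable1_diffP; have [] := dp p.
- exact: continuous_mul.
- exact: continuous_mul.
- by move=> p; exact: is_derive_comp.
- by move=> p; exact: is_derive_comp.
Qed.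

Lemma has_grad_inv g g1 g2 : has_grad g g1 g2 -> (forall p, g p != 0) ->
  has_grad (fun p => (g p)^-1) (fun p => - (g p)^-2 * g1 p)
           (fun p => - (g p)^-2 * g2 p).
Proof.
move=> hg g0; have [cg _ _ _ _] := hg.
apply: (has_grad_comp (phi := fun x => x^-1) (dphi := fun x => - x^-2)) => //.
- move=> p; apply: (is_derive_eq (is_deriveV (g0 p) (is_derive_id _ _))).
  by rewrite [LHS]mulr1.
- move=> p; apply: cvgN; apply: cvgV; first by rewrite expf_neq0.
  by apply: (@continuous_comp _ _ _ g (fun x => x ^+ 2));
    [exact: cg|exact: exprn_continuous].
Qed.

Lemma has_grad_sqrt g g1 g2 : has_grad g g1 g2 -> (forall p, 0 < g p) ->
  has_grad (fun p => Num.sqrt (g p)) (fun p => (2 * Num.sqrt (g p))^-1 * g1 p)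
           (fun p => (2 * Num.sqrt (g p))^-1 * g2 p).
Proof.
move=> hg g0; have [cg _ _ _ _] := hg.
apply: (has_grad_comp (phi := Num.sqrt) (dphi := fun x => (2 * Num.sqrt x)^-1)) => //.
- by move=> p; exact: is_derive1_sqrt.
- apply: continuous_inv; last by move=> p; rewrite mulf_neq0// gt_eqF// sqrtr_gt0.
  apply: continuous_mul; first exact: continuous_const.
  by move=> p; apply: (@continuous_comp _ _ _ g Num.sqrt);
    [exact: cg|exact: sqrt_continuous].
Qed.

End grad.

Section continuity_vector.
Context {R : realType} {T : topologicalType}.
Implicit Types a b : T -> 'rV[R]_4.

Lemma continuous_dot a b : continuous a -> continuous b ->
  continuous (fun p => dot (a p) (b p)).
Proof.
move=> ca cb; apply: continuous_big => [|i _]; first exact: add_continuous.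
move=> p; apply: cvgM.
- by apply: (@continuous_comp _ _ _ a (fun M => M 0 i));
    [exact: ca|exact: coord_continuous].
- by apply: (@continuous_comp _ _ _ b (fun M => M 0 i));
    [exact: cb|exact: coord_continuous].
Qed.

Lemma continuous_vscale (k : T -> R) a : continuous k -> continuous a ->
  continuous (fun p => k p *: a p).
Proof. by move=> ck ca p; apply: cvgZ; [exact: ck|exact: ca]. Qed.

Lemma continuous_vadd a b : continuous a -> continuous b ->
  continuous (fun p => a p + b p).
Proof. by move=> ca cb p; apply: cvgD; [exact: ca|exact: cb]. Qed.

Lemma continuous_vsub a b : continuous a -> continuous b ->
  continuous (fun p => a p - b p).
Proof. by move=> ca cb p; apply: cvgB; [exact: ca|exact: cb]. Qed.

Lemma continuous_vsub_cst a (c : 'rV[R]_4) : continuous a -> continuous (fun p => a p - c).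
Proof. by move=> ca p; apply: cvgB; [exact: ca|exact: cvg_cst]. Qed.
End continuity_vector.

Section vector_gradient.
Context {R : realType}.
Local Notation e1 := ((1, 0) : R * R).
Local Notation e2 := ((0, 1) : R * R).
Implicit Types a b : R * R -> 'rV[R]_4.

Definition has_vgrad a a1 a2 := [/\ continuous a, continuous a1, continuous a2,
  (forall p, is_derive p e1 a (a1 p)) & (forall p, is_derive p e2 a (a2 p))].

Lemma has_grad_dot a a1 a2 b b1 b2 : has_vgrad a a1 a2 -> has_vgrad b b1 b2 ->
  has_grad (fun p => dot (a p) (b p)) (fun p => dot (a1 p) (b p) + dot (a p) (b1 p))
    (fun p => dot (a2 p) (b p) + dot (a p) (b2 p)).
Proof.
move=> [ca ca1 ca2 da1 da2] [cb cb1 cb2 db1 db2]; split.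
- exact: continuous_dot.
- by apply: continuous_add; exact: continuous_dot.
- by apply: continuous_add; exact: continuous_dot.
- by move=> p; exact: is_derive_dot.
- by move=> p; exact: is_derive_dot.
Qed.
End vector_gradient.

(** * The tangent plane of a parametrized surface *)

Lemma invmx_unique {R : comUnitRingType} n (M N : 'M[R]_n) : M *m N = 1%:M -> invmx M = N.
Proof.
move=> MN; have /andP[uM _] : (M \in unitmx) && (N \in unitmx).
  by have [-> ->] := mulmx1_unit MN.
by rewrite -[LHS]mulmx1 -MN mulKmx.
Qed.

Lemma sum_ord2 {V : nmodType} (F : 'I_2 -> V) : \sum_(i < 2) F i = F 0 + F 1.
Proof.
rewrite !big_ord_recl big_ord0 addr0; congr (_ + F _); exact: val_inj.
Qed.

Lemma ord2P (k : 'I_2) : k = 0 \/ k = 1.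
Proof. by case: k => -[|[|//]] hk; [left|right]; exact: val_inj. Qed.

Lemma det_mx22 {R : comNzRingType} (M : 'M[R]_2) :
  \det M = M 0 0 * M 1 1 - M 0 1 * M 1 0.
Proof.
rewrite (expand_det_row _ 0) sum_ord2 /cofactor !det_mx11 !mxE/=.
have -> : lift 0 0 = 1 :> 'I_2 by exact: val_inj.
have -> : lift 1 0 = 0 :> 'I_2 by exact: val_inj.
rewrite /= expr0 expr1; ring.
Qed.

Section tangent_plane.
Context {R : realType}.
Variables x y : 'rV[R]_4.

Definition frame : 'M[R]_(2, 4) := \matrix_(i < 2) (if i == 0 then x else y).
(** The square of the area of the parallelogram spanned by [x] and [y]. *)
Definition gram : R := dot x x * dot y y - dot x y * dot x y.
(** Cramer's rule for the coefficients of the orthogonal projection onto the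
plane spanned by [x] and [y]. *)
Definition frame_coef1 (u : 'rV[R]_4) := (dot y y * dot x u - dot x y * dot y u) / gram.
Definition frame_coef2 (u : 'rV[R]_4) := (dot x x * dot y u - dot x y * dot x u) / gram.
Definition tangent_part u := frame_coef1 u *: x + frame_coef2 u *: y.

Lemma frame_sqr : frame *m frame^T = \matrix_(i, j)
  (if i == 0 then (if j == 0 then dot x x else dot x y)
   else (if j == 0 then dot x y else dot y y)).
Proof.
apply/matrixP => i j; rewrite [LHS]mxE [RHS]mxE.
have -> : \sum_j0 frame i j0 * frame^T j0 j =
    dot (if i == 0 then x else y) (if j == 0 then x else y).
  by apply: eq_bigr => k _; rewrite !mxE.
by case: ifP => _; case: ifP => _ //; exact: dotC.
Qed.

Lemma gramE : gram = \det (frame *m frame^T).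
Proof. by rewrite det_mx22 frame_sqr !mxE. Qed.

Hypothesis free_frame : row_free frame.

Lemma frame_free a b : a *: x + b *: y = 0 -> a = 0 /\ b = 0.
Proof.
move=> ab; have : (\row_(i < 2) (if i == 0 then a else b)) *m frame = 0.
  by rewrite mulmx_sum_row sum_ord2 !mxE/= !rowK.
move=> /eqP; rewrite mulmx_free_eq0// => /eqP/rowP h.
by have := h 0; have := h 1; rewrite !mxE/=.
Qed.

Lemma frame1_gt0 : 0 < dot x x.
Proof.
rewrite lt_def dot_ge0 andbT dot_eq0; apply/eqP => x0.
have [] := @frame_free 1 0; first by rewrite x0 scaler0 scale0r addr0.
by move=> /eqP; rewrite oner_eq0.
Qed.

Lemma frame2_gt0 : 0 < dot y y.
Proof.
rewrite lt_def dot_ge0 andbT dot_eq0; apply/eqP => y0.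
have [] := @frame_free 0 1; first by rewrite y0 scaler0 scale0r addr0.
by move=> _ /eqP; rewrite oner_eq0.
Qed.

Lemma gram_gt0 : 0 < gram.
Proof.
rewrite -(pmulr_rgt0 _ frame1_gt0).
have -> : dot x x * gram = dot (dot x x *: y - dot x y *: x) (dot x x *: y - dot x y *: x).
  by rewrite !dot_lin (dotC y x) /gram; ring.
rewrite lt_def dot_ge0 andbT dot_eq0; apply/eqP => h.
have [|_ /eqP] := @frame_free (- dot x y) (dot x x); last by rewrite gt_eqF// frame1_gt0.
by rewrite scaleNr addrC.
Qed.

Lemma invmx_frame_sqr : invmx (frame *m frame^T) =
  \matrix_(i, j) ((if i == 0 then (if j == 0 then dot y y else - dot x y)
                   else (if j == 0 then - dot x y else dot x x)) / gram).
Proof.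
apply: invmx_unique; apply/matrixP => i j.
have D0 := lt0r_neq0 gram_gt0; rewrite /gram in D0 *.
rewrite mxE frame_sqr sum_ord2 !mxE.
have [->|->] := ord2P i; have [->|->] := ord2P j; rewrite /=.
all: by field.
Qed.

Lemma mul_tangent_projection u :
  u *m (frame^T *m invmx (frame *m frame^T) *m frame) = tangent_part u.
Proof.
rewrite !mulmxA invmx_frame_sqr.
have -> : u *m frame^T = \row_i (if i == 0 then dot x u else dot y u).
  apply/rowP => i; rewrite [LHS]mxE [RHS]mxE.
  by case: ifP => i0; apply: eq_bigr => j _; rewrite !mxE i0 mulrC.
rewrite mulmx_sum_row sum_ord2 !rowK !mxE !sum_ord2 !mxE/= /tangent_part /frame_coef1
  /frame_coef2.
by congr (_ *: _ + _ *: _); ring.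
Qed.

Lemma dot_tangent_part u v : dot (tangent_part u) v =
  frame_coef1 u * dot x v + frame_coef2 u * dot y v.
Proof. by rewrite /tangent_part !dot_lin. Qed.

Lemma normal_part_orth u : dot x (u - tangent_part u) = 0 /\ dot y (u - tangent_part u) = 0.
Proof.
have D0 := lt0r_neq0 gram_gt0.
rewrite /tangent_part !dot_lin (dotC y x).
rewrite /frame_coef1 /frame_coef2 /gram in D0 *.
by split; field.
Qed.

Lemma dot_normal_part u v : dot x u = 0 -> dot y u = 0 ->
  dot u (v - tangent_part v) = dot u v.
Proof.
by move=> xu yu; rewrite dotBr (dotC u (tangent_part v)) dot_tangent_part xu yu; ring.
Qed.

Definition tangent_sqr u := dot (tangent_part u) u.

Lemma normal_sqr u : dot (u - tangent_part u) (u - tangent_part u) =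
  dot u u - tangent_sqr u.
Proof.
have [a b] := normal_part_orth u.
rewrite [LHS]dotBl dot_tangent_part a b dotBr.
by rewrite (dotC u (tangent_part u)) /tangent_sqr; ring.
Qed.

Lemma tangent_sqrE u : tangent_sqr u = (dot y y * dot x u ^+ 2
  - 2 * dot x y * dot x u * dot y u + dot x x * dot y u ^+ 2) / gram.
Proof. by rewrite /tangent_sqr dot_tangent_part /frame_coef1 /frame_coef2; ring. Qed.

Lemma tangent_sqr_ge0 u : 0 <= tangent_sqr u.
Proof.
have -> : tangent_sqr u = dot (tangent_part u) (tangent_part u).
  have [a b] := normal_part_orth u.
  have := dot_tangent_part u (u - tangent_part u).
  by rewrite a b !mulr0 addr0 dotBr /tangent_sqr => /eqP; rewrite subr_eq0 => /eqP.
exact: dot_ge0.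
Qed.

Lemma tangent_sqr_le u : tangent_sqr u <= dot u u.
Proof. by rewrite -subr_ge0 -normal_sqr dot_ge0. Qed.

(** Pairing with a normal vector only sees the normal part of [u].  This is what
allows the curvature term to be absorbed in [cutoff_pointwise]. *)
Lemma normal_dot_le h u : dot x h = 0 -> dot y h = 0 ->
  dot h u ^+ 2 <= dot h h * (dot u u - tangent_sqr u).
Proof.
move=> xh yh; rewrite -normal_sqr -(dot_normal_part u xh yh).
exact: dot_cauchy_schwarz.
Qed.
End tangent_plane.

(** * First variation and the local energy inequality *)

Section periodic.
Context {R : realType}.

Lemma vgrad_periodic (f f1 f2 : R * R -> 'rV[R]_4) : has_vgrad f f1 f2 ->
  Defs.periodic f -> Defs.periodic f1 /\ Defs.periodic f2.
Proof.
move=> [_ _ _ d1 d2] pf.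
have shift c v g : (forall p, f (p + c) = f p) -> (forall p, is_derive p v f (g p)) ->
    forall p, g (p + c) = g p.
  move=> fc dg p; rewrite -(@derive_val _ _ _ _ _ _ _ (dg p)).
  rewrite -(@derive_val _ _ _ _ _ _ _ (dg (p + c))) /derive/=.
  have -> : (fun h : R => h^-1 *: (f (h *: v + (p + c)) - f (p + c))) =
            (fun h : R => h^-1 *: (f (h *: v + p) - f p)).
    by apply/funext => h; rewrite addrA !fc.
  by [].
have c1 p : f (p + (1, 0)) = f p.
  by case: p => x y; have [<- _] := pf x y; congr f; congr pair; rewrite /= addr0.
have c2 p : f (p + (0, 1)) = f p.
  by case: p => x y; have [_ <-] := pf x y; congr f; congr pair; rewrite /= addr0.
have E1 x y : (x + 1, y) = (x, y) + (1, 0) :> R * R by congr pair; rewrite /= addr0.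
have E2 x y : (x, y + 1) = (x, y) + (0, 1) :> R * R by congr pair; rewrite /= addr0.
by split=> x y; rewrite E1 E2; split; apply: shift.
Qed.
End periodic.

Section cutoff.
Context {R : realType}.

(** Once continuously differentiable, equal to 1 at [s = 0] and vanishing for
[s >= rho]; it is applied to squared distances, so [rho] is a squared radius. *)
Definition cutoff (rho s : R) := pos2 (1 - s / rho).
Definition ramp (rho s : R) := Num.max 0 (1 - s / rho).

Lemma continuous_ramp (T : topologicalType) rho (s : T -> R) : continuous s ->
  continuous (fun p => ramp rho (s p)).
Proof.
move=> cs; apply: continuous_pos => p.
by apply: cvgB; [exact: cvg_cst|apply: cvgMl; exact: cs].
Qed.

Lemma cutoffE (rho s : R) : cutoff rho s = ramp rho s ^+ 2. Proof. by []. Qed.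

Lemma ramp_ge0 (rho s : R) : 0 <= ramp rho s.
Proof. by rewrite le_max lexx. Qed.

Lemma ramp_le1 (rho s : R) : 0 < rho -> 0 <= s -> ramp rho s <= 1.
Proof. by move=> r0 s0; rewrite ge_max ler01 lerBlDr lerDl divr_ge0// ltW. Qed.

Lemma ramp_eq0 (rho s : R) : 0 < rho -> rho <= s -> ramp rho s = 0.
Proof.
by move=> r0 rs; apply/max_idPl; rewrite subr_le0 ler_pdivlMr// mul1r.
Qed.

Lemma continuous_cutoff (T : topologicalType) rho (s : T -> R) : continuous s ->
  continuous (fun p => cutoff rho (s p)).
Proof.
by move=> cs p; apply: cvgM; exact: continuous_ramp.
Qed.

(** With [s = |x|^2], the field [radial_weight rho e s *: x] is Simon's field
[x / |x|^2], cut off at distance [sqrt rho] and made regular at the origin by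
[e]. *)
Definition radial_weight (rho e s : R) := cutoff rho s / (s + e).
Definition dradial_weight (rho e s : R) :=
  - (2 / rho) * ramp rho s / (s + e) - cutoff rho s / (s + e) ^+ 2.

Lemma is_derive_radial_weight (rho e s : R) : 0 < e -> 0 <= s ->
  is_derive s (1 : R) (radial_weight rho e) (dradial_weight rho e s).
Proof.
move=> e0 s0; have m0 : s + e != 0 by rewrite gt_eqF// ltr_wpDl.
have d1 : is_derive s (1 : R) (fun x => 1 - x / rho) (- rho^-1).
  apply: (@is_derive_eq _ _ _ _ _ _ _ _ (is_derive_sub (is_derive_cst (1 : R) s (1 : R))
    (is_derive_mul (is_derive_id s (1 : R)) (is_derive_cst (rho^-1 : R) s (1 : R))))).
  by rewrite mulr0 addr0 mul1r sub0r.
have d2 := @is_derive_comp _ _ pos2 (fun x : R => 1 - x / rho) _ _ _ _ (is_derive_pos2 _)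
  d1.
have d3 : is_derive s (1 : R) (fun x => x + e) 1.
  apply: (@is_derive_eq _ _ _ _ _ _ _ _ (is_derive_add (is_derive_id s (1 : R))
      (is_derive_cst (e : R) s (1 : R)))).
  by rewrite addr0.
have d4 := @is_deriveV _ (fun x : R => x + e) _ _ _ m0 d3.
apply: (is_derive_eq (is_derive_mul d2 d4)).
rewrite /dradial_weight /cutoff /ramp [(- _)%:A]mulr1.
by move: (rho^-1) => k; field.
Qed.


(** On the set where [s <= 2 eps^2], the regularized density is comparable to
the inverse of the area [eps^2] of a disc of radius [eps].  Here [e = eps^2],
[q] is the area element at the centre and [a] the area element at a point;
the constant is [1/36 = 2 * 1/4 * 1/9 * 1/2]. *)
Lemma radial_weight_density_ge (rho eps s a q : R) : 0 < eps -> 4 * eps ^+ 2 <= rho ->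
  0 <= s -> s <= 2 * eps ^+ 2 -> 0 < q -> q / 2 <= a ->
  q / (36 * eps ^+ 2) <= 2 * eps ^+ 2 * cutoff rho s / (s + eps ^+ 2) ^+ 2 * a.
Proof.
move=> eps0 epsrho s0 sz q0 az.
have e20 : 0 < eps ^+ 2 by rewrite exprn_gt0.
have rho0 : 0 < rho by lra.
have half : 2^-1 <= ramp rho s.
  rewrite le_max; apply/orP; right.
  have : s / rho <= 2^-1 by rewrite ler_pdivrMr//; lra.
  lra.
have cut : 4^-1 <= cutoff rho s.
  rewrite cutoffE (_ : 4^-1 = 2^-1 ^+ 2); first by rewrite lerXn2r ?nnegrE ?ramp_ge0.
  by field.
have den : (9 * eps ^+ 2 ^+ 2)^-1 <= ((s + eps ^+ 2) ^+ 2)^-1.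
  rewrite lef_pV2 ?posrE ?mulr_gt0 ?exprn_gt0 ?ltr_wpDl//.
  rewrite (_ : 9 * _ = (3 * eps ^+ 2) ^+ 2); last by ring.
  by rewrite lerXn2r ?nnegrE; lra.
have -> : q / (36 * eps ^+ 2) = 2 * eps ^+ 2 * 4^-1 / (9 * eps ^+ 2 ^+ 2) * (q / 2).
  by field; rewrite gt_eqF.
apply: ler_pM => //.
- by rewrite divr_ge0 ?mulr_ge0// ?sqr_ge0// ltW.
- by rewrite divr_ge0// ltW.
apply: ler_pM => //.
- by rewrite mulr_ge0// ltW// mulr_gt0.
- by rewrite invr_ge0 mulr_ge0// sqr_ge0.
by rewrite ler_pM2l// mulr_gt0.
Qed.

(** The integrand of the first variation formula, estimated from below.  With
[x = (s - t) / (s + e)^2] the squared length of the normal part of the field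
and [y = eta / (s + e)] its product with the curvature, the claim for the
terms with [chi] is [0 <= 2 x + y + N / 8].  It follows from [y^2 <= N x] and
[(2 x + N / 8)^2 - N x = (2 x - N / 8)^2 >= 0].  The terms with [dchi] differ by
[- 2 dchi (1 - t / (s + e))], which is nonnegative. *)
Lemma cutoff_pointwise (chi dchi e s t eta N : R) : 0 <= chi -> dchi <= 0 ->
  0 < e -> 0 <= t <= s -> eta ^+ 2 <= N * (s - t) -> 0 <= N ->
  2 * e * chi / (s + e) ^+ 2 - (chi * N / 8 - 2 * dchi) <=
  2 * (chi / (s + e)) + 2 * (dchi / (s + e) - chi / (s + e) ^+ 2) * t +
    chi / (s + e) * eta.
Proof.
move=> chi0 dchi0 e0 /andP[t0 ts] etaN N0.
have m0 : 0 < s + e by lra.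
rewrite -subr_ge0; set X := (X in 0 <= X).
have -> : X = chi * (2 * ((s - t) / (s + e) ^+ 2) + eta / (s + e) + N / 8) +
    (- (2 * dchi)) * (1 - t / (s + e)).
  by rewrite /X; field; rewrite gt_eqF.
apply: addr_ge0; apply: mulr_ge0 => //; last 2 first.
- lra.
- by rewrite subr_ge0 ler_pdivrMr//; lra.
set x := (s - t) / _; set y := eta / _.
have x0 : 0 <= x by rewrite divr_ge0 ?sqr_ge0//; lra.
have yx : y ^+ 2 <= N * x by rewrite expr_div_n /x mulrA ler_pM2r// invr_gt0 exprn_gt0.
have : `|y| <= 2 * x + N / 8.
  rewrite -ler_sqr ?nnegrE//; last lra.
  rewrite real_normK ?num_real// (le_trans yx)// -subr_ge0.
  have -> : (2 * x + N / 8) ^+ 2 - N * x = (2 * x - N / 8) ^+ 2 by field.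
  exact: sqr_ge0.
rewrite ler_norml => /andP[]; lra.
Qed.
End cutoff.

Section surface.
Context {R : realType}.
Variables f f1 f2 f11 f12 f22 : R * R -> 'rV[R]_4.
Hypothesis hf : has_vgrad f f1 f2.
Hypothesis hf1 : has_vgrad f1 f11 f12.
Hypothesis hf2 : has_vgrad f2 f12 f22.
Hypothesis f_periodic : Defs.periodic f.
Hypothesis free : forall p, row_free (frame (f1 p) (f2 p)).

Definition area_element p : R := Num.sqrt (gram (f1 p) (f2 p)).

(** The trace, with respect to the induced metric, of the second coordinate
derivatives: it differs from the Laplacian of [f] for the induced metric by a
tangent vector. *)
Definition metric_laplacian p := (gram (f1 p) (f2 p))^-1 *:
  (dot (f2 p) (f2 p) *: f11 p - (2 * dot (f1 p) (f2 p)) *: f12 p +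
   dot (f1 p) (f1 p) *: f22 p).

(** The mean curvature vector of the surface in R^4. *)
Definition curvature_vector p :=
  metric_laplacian p - tangent_part (f1 p) (f2 p) (metric_laplacian p).

Lemma area_element_gt0 p : 0 < area_element p.
Proof. by rewrite sqrtr_gt0 gram_gt0. Qed.

Lemma area_element_sqr p : area_element p ^+ 2 = gram (f1 p) (f2 p).
Proof. by rewrite sqr_sqrtr// ltW// gram_gt0. Qed.

(** The pointwise form of the first variation formula, as an identity between
rational functions.  [E], [F], [G] are the coefficients of the metric, [q] is
the area element, [a] and [b] are the products of the position vector [u] with
the coordinate vectors, [cij] its products with the second derivatives, and
[dijk] the products of the second derivative [ij] with the coordinate vector
[k].  [P] and [P'] stand for [psi] and its derivative.  The left side is the sum
of the derivatives of the two components of the tangent part of [psi u], each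
multiplied by [q], in the form that the rules for products, inverses and square
roots produce. *)
Lemma divergence_identity (E F G q a b c11 c12 c22 d111 d112 d121 d122 d221 d222 P P' : R) :
  0 < E -> 0 < q -> q ^+ 2 = E * G - F * F ->
  P' * (a + a) * ((G * a - F * b) / q) +
  P * (((d122 + d122) * a + G * (c11 + E) - ((d112 + d121) * b + F * (c12 + F))) / q
       + (G * a - F * b) * (- q ^- 2 *
          ((2 * q)^-1 * ((d111 + d111) * G + E * (d122 + d122) -
            ((d112 + d121) * F + F * (d112 + d121)))))) +
  (P' * (b + b) * ((E * b - F * a) / q) +
  P * (((d121 + d121) * b + E * (c22 + G) - ((d122 + d221) * a + F * (c12 + F))) / q
       + (E * b - F * a) * (- q ^- 2 *
          ((2 * q)^-1 * ((d121 + d121) * G + E * (d222 + d222) -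
            ((d122 + d221) * F + F * (d122 + d221))))))) =
  q * (2 * P + 2 * P' * ((G * a ^+ 2 - 2 * F * a * b + E * b ^+ 2) / q ^+ 2) +
    P * ((q ^+ 2)^-1 * (G * c11 - 2 * F * c12 + E * c22) -
     ((G * ((q ^+ 2)^-1 * (G * d111 - 2 * F * d121 + E * d221)) -
       F * ((q ^+ 2)^-1 * (G * d112 - 2 * F * d122 + E * d222))) / q ^+ 2 * a +
      (E * ((q ^+ 2)^-1 * (G * d112 - 2 * F * d122 + E * d222)) -
       F * ((q ^+ 2)^-1 * (G * d111 - 2 * F * d121 + E * d221))) / q ^+ 2 * b))).
Proof.
(* The relation between the four variables is eliminated by solving it for [G]. *)
move=> E0 q0 qE; have -> : G = (q ^+ 2 + F * F) / E.
  by rewrite qE subrK mulrC mulKf// gt_eqF.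
field.
by rewrite !gt_eqF.
Qed.

(** The integrand is the area element times the divergence on the surface of the
field [psi (|u|^2) u] plus its product with the curvature vector.  This sum is
the divergence of the tangent part of the field, whose coordinate expression
has integral zero over the torus. *)
Lemma divergence_theorem (x0 : 'rV[R]_4) (psi dpsi : R -> R)
    (u := fun p => f p - x0) (s := fun p => dot (u p) (u p)) :
  (forall x : R, 0 <= x -> is_derive x (1 : R) psi (dpsi x)) ->
  continuous (fun p => dpsi (s p)) ->
  square_integral (fun p => area_element p * (2 * psi (s p) +
    2 * dpsi (s p) * tangent_sqr (f1 p) (f2 p) (u p) +
    psi (s p) * dot (curvature_vector p) (u p))) = 0.
Proof.
move=> psiP cdpsi.
have hu : has_vgrad u f1 f2.
  have [cf cf1 cf2 d1 d2] := hf; split => //.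
  - exact: continuous_vsub_cst.
  - by move=> p; rewrite -[f1 p]subr0; apply: is_deriveB; exact: is_derive_cst.
  - by move=> p; rewrite -[f2 p]subr0; apply: is_deriveB; exact: is_derive_cst.
have hs := has_grad_dot hu hu.
have hpsi := has_grad_comp hs (fun p => psiP _ (dot_ge0 (u p))) cdpsi.
have hE := has_grad_dot hf1 hf1.
have hF := has_grad_dot hf1 hf2.
have hG := has_grad_dot hf2 hf2.
have hD := has_grad_sub (has_grad_mul hE hG) (has_grad_mul hF hF).
have D0 p : 0 < gram (f1 p) (f2 p) by exact: gram_gt0.
have hq := has_grad_sqrt hD D0.
have hiq := has_grad_inv hq (fun p => lt0r_neq0 (area_element_gt0 p)).
have ha := has_grad_dot hf1 hu.
have hb := has_grad_dot hf2 hu.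
have hY1 := has_grad_mul hpsi
  (has_grad_mul (has_grad_sub (has_grad_mul hG ha) (has_grad_mul hF hb)) hiq).
have hY2 := has_grad_mul hpsi
  (has_grad_mul (has_grad_sub (has_grad_mul hE hb) (has_grad_mul hF ha)) hiq).
have [pf1 pf2] := vgrad_periodic hf f_periodic.
have per (g : R * R -> 'rV[R]_4) : Defs.periodic g ->
    (forall y, g (0, y) = g (1, y)) /\ (forall x, g (x, 0) = g (x, 1)).
  move=> pg; split=> [y|x]; first by have [<- _] := pg 0 y; rewrite add0r.
  by have [_ <-] := pg x 0; rewrite add0r.
have [e e'] := per _ f_periodic; have [e1 e1'] := per _ pf1; have [e2 e2'] := per _ pf2.
have [_ cY1 _ dY1 _] := hY1; have [_ _ cY2 _ dY2] := hY2.
have I1 := square_integral_derive1 cY1 dY1.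
have I2 := square_integral_derive2 cY2 dY2.
have -> : 0 = 0 + 0 :> R by rewrite addr0.
rewrite -[X in _ = X + _]I1; last first.
  by move=> y; rewrite /u e e1 e2.
rewrite -[X in _ = _ + X]I2; last first.
  by move=> x; rewrite /u e' e1' e2'.
rewrite -square_integralD//; congr square_integral; apply/funext => p.
move: (divergence_identity (dot (f1 p) (u p)) (dot (f2 p) (u p))
  (dot (f11 p) (u p)) (dot (f12 p) (u p)) (dot (f22 p) (u p))
  (dot (f11 p) (f1 p)) (dot (f11 p) (f2 p)) (dot (f12 p) (f1 p)) (dot (f12 p) (f2 p))
  (dot (f22 p) (f1 p)) (dot (f22 p) (f2 p)) (psi (s p)) (dpsi (s p))
  (frame1_gt0 (free p)) (area_element_gt0 p) (area_element_sqr p)) => identity.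
rewrite tangent_sqrE /curvature_vector dotBl dot_tangent_part.
rewrite /frame_coef1 /frame_coef2 /metric_laplacian.
rewrite -/(gram (f1 p) (f2 p)) -/(area_element p) -area_element_sqr -/(s p).
move: identity; move: (s p) => r; move: (u p) => v identity.
rewrite !dot_lin.
rewrite (dotC (f2 p) (f1 p)) (dotC v (f1 p)) (dotC v (f2 p)).
rewrite (dotC (f1 p) (f11 p)) (dotC (f2 p) (f11 p)) (dotC (f1 p) (f12 p)).
rewrite (dotC (f2 p) (f12 p)) (dotC (f1 p) (f22 p)) (dotC (f2 p) (f22 p)).
exact/esym.
Qed.

Lemma curvature_vector_orth p : dot (f1 p) (curvature_vector p) = 0 /\
  dot (f2 p) (curvature_vector p) = 0.
Proof. exact: normal_part_orth. Qed.

Lemma continuous_frame : [/\ continuous (fun p => dot (f1 p) (f1 p)),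
  continuous (fun p => dot (f1 p) (f2 p)) & continuous (fun p => dot (f2 p) (f2 p))].
Proof.
by have [c1 _ _ _ _] := hf1; have [c2 _ _ _ _] := hf2; split; exact: continuous_dot.
Qed.

Lemma continuous_gram : continuous (fun p => gram (f1 p) (f2 p)).
Proof.
by have [c1 c2 c3] := continuous_frame; apply: continuous_sub; exact: continuous_mul.
Qed.

Lemma continuous_area_element : continuous area_element.
Proof.
move=> p; apply: (@continuous_comp _ _ _ (fun p => gram (f1 p) (f2 p)) Num.sqrt).
  exact: continuous_gram.
exact: sqrt_continuous.
Qed.

Lemma continuous_invgram : continuous (fun p => (gram (f1 p) (f2 p))^-1).
Proof.
apply: continuous_inv; first exact: continuous_gram.
by move=> p; rewrite gt_eqF// gram_gt0.
Qed.

Lemma continuous_tangent (w : R * R -> 'rV[R]_4) : continuous w ->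
  continuous (fun p => tangent_part (f1 p) (f2 p) (w p)).
Proof.
move=> cw; have [c1 _ _ _ _] := hf1; have [c2 _ _ _ _] := hf2.
have [cE cF cG] := continuous_frame; have cD := continuous_invgram.
by apply: continuous_vadd; apply: continuous_vscale => //; apply: continuous_mul => //;
  apply: continuous_sub; apply: continuous_mul => //; exact: continuous_dot.
Qed.

Lemma continuous_curvature_vector : continuous curvature_vector.
Proof.
have [_ c11 c12 _ _] := hf1; have [_ _ c22 _ _] := hf2.
have [cE cF cG] := continuous_frame; have cD := continuous_invgram.
have ch : continuous metric_laplacian.
  apply: continuous_vscale => //; apply: continuous_vadd; last exact: continuous_vscale.
  apply: continuous_vsub; apply: continuous_vscale => //.
  by apply: continuous_mul => //; exact: continuous_const.
exact: (continuous_vsub ch (continuous_tangent ch)).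
Qed.

(** Simon's monotonicity inequality in an integrated form.  The field of
[divergence_theorem] is cut off at distance [sqrt rho]; the derivative of the
cutoff produces the area term with the factor [4 / rho]. *)
Lemma energy_inequality (x0 : 'rV[R]_4) (rho e : R)
    (s := fun p => dot (f p - x0) (f p - x0)) :
  0 < rho -> 0 < e ->
  square_integral (fun p => 2 * e * cutoff rho (s p) / (s p + e) ^+ 2 * area_element p) <=
  8^-1 * square_integral (fun p =>
    cutoff rho (s p) * (dot (curvature_vector p) (curvature_vector p) * area_element p)) +
  4 / rho * square_integral (fun p => ramp rho (s p) * area_element p).
Proof.
move=> rho0 e0.
have [cf c1 c2 _ _] := hf.
have cu : continuous (fun p => f p - x0) by exact: continuous_vsub_cst.
have cs : continuous s by exact: continuous_dot.
have s0 p : 0 <= s p by exact: dot_ge0.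
have cm : continuous (fun p => (s p + e)^-1).
  apply: continuous_inv; first by apply: continuous_add => //; exact: continuous_const.
  by move=> p; rewrite gt_eqF// ltr_wpDl.
have cm2 : continuous (fun p => ((s p + e) ^+ 2)^-1).
  have -> : (fun p => ((s p + e) ^+ 2)^-1) = (fun p => (s p + e)^-1 * (s p + e)^-1).
    by apply/funext => p; rewrite expr2 invfM.
  exact: continuous_mul.
have cb := continuous_cutoff (rho := rho) cs.
have cr := continuous_ramp (rho := rho) cs.
have ca := continuous_area_element.
have cN : continuous (fun p => dot (curvature_vector p) (curvature_vector p)).
  by apply: continuous_dot; exact: continuous_curvature_vector.
have cd : continuous (fun p => dradial_weight rho e (s p)).
  apply: continuous_sub; last exact: continuous_mul.
  by apply: continuous_mul => //; apply: continuous_mul => //; exact: continuous_const.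
have I := divergence_theorem (fun x x0 => is_derive_radial_weight rho e0 x0) cd.
have ck : continuous (fun p => radial_weight rho e (s p)) by exact: continuous_mul.
have cT : continuous (fun p => tangent_sqr (f1 p) (f2 p) (f p - x0)).
  exact: (continuous_dot (continuous_tangent cu) cu).
have cI1 : continuous (fun p => 2 * e * cutoff rho (s p) / (s p + e) ^+ 2 * area_element p).
  apply: continuous_mul => //; apply: continuous_mul => //.
  by apply: continuous_mul => //; exact: continuous_const.
have cI2 : continuous (fun p =>
    cutoff rho (s p) * (dot (curvature_vector p) (curvature_vector p) * area_element p)).
  by apply: continuous_mul => //; exact: continuous_mul.
have cI3 : continuous (fun p => ramp rho (s p) * area_element p) by exact: continuous_mul.
pose J p := area_element p * (2 * radial_weight rho e (s p) +
  2 * dradial_weight rho e (s p) * tangent_sqr (f1 p) (f2 p) (f p - x0) +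
  radial_weight rho e (s p) * dot (curvature_vector p) (f p - x0)).
have cJ : continuous J.
  have c1' := continuous_mul (@continuous_const R _ 2) ck.
  have c2' := continuous_mul (continuous_mul (@continuous_const R _ 2) cd) cT.
  have c3' := continuous_mul ck (continuous_dot continuous_curvature_vector cu).
  exact: (continuous_mul ca (continuous_add (continuous_add c1' c2') c3')).
have I0 : square_integral J = 0 by exact: I.
have cK2 := continuous_mul (@continuous_const R _ (8^-1)) cI2.
have cK3 := continuous_mul (@continuous_const R _ (4 / rho)) cI3.
rewrite -(square_integralZ (8^-1) cI2) -(square_integralZ (4 / rho) cI3) -[leRHS]addr0 -I0.
rewrite -(square_integralD cK2 cK3) -(square_integralD (continuous_add cK2 cK3) cJ).
apply: (square_integral_le cI1 (continuous_add (continuous_add cK2 cK3) cJ)) => p.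
have [h1 h2] := curvature_vector_orth p.
have tt : 0 <= tangent_sqr (f1 p) (f2 p) (f p - x0) <= s p.
  by rewrite tangent_sqr_ge0// tangent_sqr_le.
have dn : - (2 / rho) * ramp rho (s p) <= 0.
  by rewrite mulNr oppr_le0 mulr_ge0 ?ramp_ge0// divr_ge0// ltW.
have bn : 0 <= cutoff rho (s p) by exact: sqr_ge0.
have := cutoff_pointwise bn dn e0 tt (normal_dot_le (free p) (f p - x0) h1 h2) (dot_ge0 _).
move=> /(ler_wpM2l (ltW (area_element_gt0 p))).
rewrite -subr_ge0 => H; rewrite -subr_ge0; apply: le_trans H _.
rewrite le_eqVlt; apply/orP; left; apply/eqP; rewrite /J /radial_weight /dradial_weight.
by field; rewrite !gt_eqF//; have := s0 p; lra.
Qed.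

End surface.

(** * Lower density bound *)

Section density.
Context {R : realType}.
Variables f f1 f2 f11 f12 f22 : R * R -> 'rV[R]_4.
Hypothesis hf : has_vgrad f f1 f2.
Hypothesis hf1 : has_vgrad f1 f11 f12.
Hypothesis hf2 : has_vgrad f2 f12 f22.
Hypothesis free : forall p, row_free (frame (f1 p) (f2 p)).

Lemma vector_expansion p (eta : R) : 0 < eta -> exists2 d, 0 < d &
  forall h k r, `|h| <= d -> `|k| <= d ->
    r = f (p.1 + h, p.2 + k) - f p - (h *: f1 p + k *: f2 p) ->
    dot r r <= 4 * (eta * (`|h| + `|k|)) ^+ 2.
Proof.
move=> eta0; have [cf cf1 cf2 d1 d2] := hf.
have cc i (g : R * R -> 'rV[R]_4) : continuous g -> continuous (fun x => g x 0 i).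
  by move=> cg q; apply: (@continuous_comp _ _ _ g (fun M => M 0 i));
    [exact: cg|exact: coord_continuous].
have /choice[d dP] : forall i : 'I_4, exists d : R, 0 < d /\
    forall h k, `|h| <= d -> `|k| <= d ->
    `|f (p.1 + h, p.2 + k) 0 i - f p 0 i - (h * f1 p 0 i + k * f2 p 0 i)| <=
      eta * (`|h| + `|k|).
  move=> i.
  have [d d0 H] := first_order_expansion (fun q => is_derive_coord i (d1 q))
    (fun q => is_derive_coord i (d2 q)) (cc i _ cf1 p) (cc i _ cf2 p) eta0.
  by exists d.
exists (\big[Num.min/1]_i d i).
  by apply: lt_bigmin => // i _; have [] := dP i.
move=> h k r hd kd ->.
have -> : 4 * (eta * (`|h| + `|k|)) ^+ 2 = \sum_(i < 4) (eta * (`|h| + `|k|)) ^+ 2.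
  by rewrite sumr_const card_ord mulr_natl.
apply: ler_sum => i _; rewrite -expr2 -[leLHS](real_normK (num_real _)).
have e0 : 0 <= eta * (`|h| + `|k|) by rewrite mulr_ge0 ?addr_ge0// ltW.
rewrite lerXn2r ?nnegrE// !mxE; have [_] := dP i; apply.
- by rewrite (le_trans hd)// bigmin_le_cond.
- by rewrite (le_trans kd)// bigmin_le_cond.
Qed.

(** Completes the square in the metric, so that the ellipse
[|h x + k y| <= eps] contains a parallelogram bounded by
[|k + slope * h| <= const] and [|h| <= const]. *)
Lemma gram_form (x y : 'rV[R]_4) (h k : R) : 0 < dot y y ->
  dot (h *: x + k *: y) (h *: x + k *: y) =
  dot y y * (k + dot x y / dot y y * h) ^+ 2 + gram x y / dot y y * h ^+ 2.
Proof. by move=> y0; rewrite !dot_lin (dotC y x) /gram; field; rewrite gt_eqF. Qed.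

Lemma dot_add_le (x y : 'rV[R]_4) : dot (x + y) (x + y) <= 2 * dot x x + 2 * dot y y.
Proof.
rewrite -subr_ge0; apply: le_trans (dot_ge0 (x - y)) _.
by rewrite !dot_lin (dotC y x) le_eqVlt; apply/orP; left; apply/eqP; ring.
Qed.

(** The parallelogram with this half width, [half_height] and [slope] lies in the
ellipse of coordinate vectors of metric length at most 1.  Its area
[4 * half_width * half_height] is the inverse of the area element, so that its
area measured in the metric is 1 for every metric. *)
Definition half_width (p : R * R) : R :=
  Num.sqrt (dot (f2 p) (f2 p)) / (2 * area_element f1 f2 p).
Definition half_height (p : R * R) : R := (2 * Num.sqrt (dot (f2 p) (f2 p)))^-1.
Definition slope (p : R * R) : R := dot (f1 p) (f2 p) / dot (f2 p) (f2 p).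

(** The values of the differential on the parallelogram have squared length at
most [eps^2 / 2], and for small [eps] the immersion is close to its differential
and the area element close to its value at the centre. *)
Lemma small_parallelogram (p : R * R) : 0 < p.1 < 1 -> 0 < p.2 < 1 ->
  exists2 m, 0 < m & forall eps, 0 < eps -> eps <= m ->
    forall z, shear p (slope p) (eps * half_width p) (eps * half_height p) z ->
    [/\ (`[0, 1] `*` `[0, 1]) z, dot (f z - f p) (f z - f p) <= 2 * eps ^+ 2
      & area_element f1 f2 p / 2 <= area_element f1 f2 z].
Proof.
move=> /andP[p1 p1'] /andP[p2 p2']; rewrite /slope.
set F := dot (f1 p) (f2 p); set G := dot (f2 p) (f2 p).
set D := gram (f1 p) (f2 p); set q := area_element f1 f2 p.
have G0 : 0 < G by exact: frame2_gt0.
have D0 : 0 < D by exact: gram_gt0.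
have q0 : 0 < q by exact: area_element_gt0.
have qD : q ^+ 2 = D by exact: area_element_sqr.
pose g := Num.sqrt G.
have g0 : 0 < g by rewrite sqrtr_gt0.
have gG : g ^+ 2 = G by rewrite sqr_sqrtr// ltW.
pose A := half_width p; pose b := half_height p; pose B := b + `|F / G| * A.
have A0 : 0 < A by rewrite divr_gt0// mulr_gt0.
have b0 : 0 < b by rewrite invr_gt0 mulr_gt0.
have B0 : 0 < B by rewrite ltr_pwDl// mulr_ge0// ltW.
pose C := A + B; have C0 : 0 < C by rewrite addr_gt0.
(* With [|h| + |k| <= eps * C], the choice of [(3 * C)^-1] makes each coordinate
   of the error of linearization at most [eps / 3]. *)
have [d d0 Hd] := @vector_expansion p (3 * C)^-1 ltac:(rewrite invr_gt0 mulr_gt0//).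
have q20 : 0 < q / 2 by rewrite divr_gt0.
have [d' d'0 Hd'] := continuous_near_box (continuous_area_element hf1 hf2 (x := p)) q20.
pose m := Num.min d (Num.min d' (Num.min (Num.min p.1 (1 - p.1)) (Num.min p.2 (1 - p.2)))).
have m0 : 0 < m by rewrite !lt_min d0 d'0 p1 p2 !subr_gt0 p1' p2'.
have [md [md' [m1 [m1' [m2 m2']]]]] : m <= d /\ m <= d' /\ m <= p.1 /\ m <= 1 - p.1 /\
    m <= p.2 /\ m <= 1 - p.2.
  by rewrite /m !ge_min !lexx !orbT.
exists (m / C); first exact: divr_gt0.
move=> eps eps0 epsC z [hA hb].
have epsm : eps * C <= m by rewrite -ler_pdivlMr.
set h := z.1 - p.1 in hA hb; set k := z.2 - p.2 in hb.
have kB : `|k| <= eps * B.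
  have kE : `|k| <= `|k + F / G * h| + `|F / G * h|.
    by rewrite -{1}(addrK (F / G * h) k) ler_normB.
  apply: (le_trans kE); rewrite (_ : eps * B = eps * b + `|F / G| * (eps * A)).
    by apply: lerD => //; rewrite normrM ler_wpM2l.
  by rewrite /B; ring.
have hm : `|h| <= m.
  by rewrite (le_trans hA)// (le_trans _ epsm)// ler_wpM2l ?ltW// /C ltrDl.
have km : `|k| <= m.
  by rewrite (le_trans kB)// (le_trans _ epsm)// ler_wpM2l ?ltW// /C ltrDr.
split.
- move: hm km; rewrite !ler_norml /h /k => /andP[? ?] /andP[? ?].
  by split => /=; rewrite in_itv/=; apply/andP; split; lra.
- have zE : (p.1 + h, p.2 + k) = z by rewrite /h /k !subrKC -surjective_pairing.
  have := Hd h k _ (le_trans hm md) (le_trans km md) erefl; rewrite zE.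
  set L := h *: f1 p + k *: f2 p; set r := f z - f p - L => rr.
  have -> : f z - f p = L + r by rewrite /r subrKC.
  apply: le_trans (dot_add_le _ _) _.
  (* The two summands of [gram_form] are at most [eps^2 / 4] each. *)
  have LL : dot L L <= eps ^+ 2 / 2.
    rewrite gram_form -/F -/G -/D//.
    have h2 : h ^+ 2 <= (eps * A) ^+ 2.
      by rewrite -(real_normK (num_real h)) lerXn2r ?nnegrE// (le_trans _ hA).
    have k2 : (k + F / G * h) ^+ 2 <= (eps * b) ^+ 2.
      by rewrite -(real_normK (num_real (k + F / G * h))) lerXn2r ?nnegrE// (le_trans _ hb).
    apply: (@le_trans _ _ (G * (eps * b) ^+ 2 + D / G * (eps * A) ^+ 2)).
      by rewrite lerD// ler_wpM2l// ltW// divr_gt0.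
    rewrite le_eqVlt; apply/orP; left; apply/eqP.
    rewrite -qD /A /b /half_width /half_height -/G -/g -/q -gG.
    by field; rewrite !gt_eqF.
  have rr2 : dot r r <= 4 / 9 * eps ^+ 2.
    apply: (le_trans rr).
    have H : (3 * C)^-1 * (`|h| + `|k|) <= eps / 3.
      rewrite mulrC ler_pdivrMr ?mulr_gt0// (_ : eps / 3 * (3 * C) = eps * A + eps * B).
        exact: lerD.
      by rewrite /C; field.
    have {}H : ((3 * C)^-1 * (`|h| + `|k|)) ^+ 2 <= (eps / 3) ^+ 2.
      by rewrite lerXn2r// nnegrE ?mulr_ge0 ?addr_ge0 ?invr_ge0 ?mulr_ge0// ltW// mulr_gt0.
    by move: H; rewrite expr_div_n; lra.
  have := sqr_ge0 eps; lra.
have : `|area_element f1 f2 z - q| <= q / 2.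
  by apply: Hd'; [exact: le_trans hm md'|exact: le_trans km md'].
by rewrite ler_norml => /andP[h1 _]; lra.
Qed.

(** On the parallelogram of [small_parallelogram], which has area comparable to
[eps^2] on the surface, the integrand is at least a multiple of [eps^-2] when
[e = eps^2]: the factors [eps^2] cancel and leave an absolute constant. *)
Lemma density_bound (p : R * R) (rho : R) (s := fun z => dot (f z - f p) (f z - f p)) :
  0 < p.1 < 1 -> 0 < p.2 < 1 -> 0 < rho ->
  exists2 e, 0 < e &
    36^-1 <= square_integral (fun z =>
      2 * e * cutoff rho (s z) / (s z + e) ^+ 2 * area_element f1 f2 z).
Proof.
move=> p1 p2 rho0; have [m m0 box] := small_parallelogram p1 p2.
(* [eps <= 1] gives [4 * eps^2 <= 4 * eps <= rho]. *)
pose eps := Num.min m (Num.min 1 (rho / 4)).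
have eps0 : 0 < eps by rewrite !lt_min m0 ltr01 divr_gt0.
have epsm : eps <= m by rewrite ge_min lexx.
have epsrho : 4 * eps ^+ 2 <= rho.
  have e1 : eps <= 1 by rewrite /eps !ge_min lexx !orbT.
  have e2 : eps <= rho / 4 by rewrite /eps !ge_min lexx !orbT.
  have : eps ^+ 2 <= eps by rewrite expr2 ger_pMl.
  by lra.
have {}box := box eps eps0 epsm.
set q := area_element f1 f2 p in box; have q0 : 0 < q by exact: area_element_gt0.
have g0 : 0 < Num.sqrt (dot (f2 p) (f2 p)) by rewrite sqrtr_gt0; exact: frame2_gt0 (free p).
have A0 : 0 <= eps * half_width p by rewrite mulr_ge0 ?divr_ge0 ?mulr_ge0// ltW.
have b0 : 0 <= eps * half_height p by rewrite mulr_ge0 ?invr_ge0 ?mulr_ge0// ltW.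
exists (eps ^+ 2); first by rewrite exprn_gt0.
have -> : 36^-1 = q / (36 * eps ^+ 2) * (4 * (eps * half_width p) * (eps * half_height p)).
  by rewrite /half_width /half_height -/q; field; rewrite !gt_eqF.
have e20 : 0 < eps ^+ 2 by rewrite exprn_gt0.
have [cf _ _ _ _] := hf.
have s0 z : 0 <= s z by exact: dot_ge0.
have cu : continuous (fun z => f z - f p) by exact: continuous_vsub_cst.
have cs : continuous s by exact: (continuous_dot cu cu).
apply: (@square_integral_ge_shear _ _ _ p (slope p)) => //.
- apply: continuous_mul; last exact: (continuous_area_element hf1 hf2).
  apply: continuous_mul.
    by apply: continuous_mul; [exact: continuous_const|exact: continuous_cutoff].
  have cm : continuous (fun z => s z + eps ^+ 2).
    by apply: continuous_add => //; exact: continuous_const.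
  apply: continuous_inv; first by move=> z; apply: cvgM; exact: cm.
  by move=> z; rewrite expf_neq0// gt_eqF// ltr_wpDl.
- move=> z; apply: mulr_ge0; last by rewrite ltW// area_element_gt0.
  by rewrite divr_ge0 ?sqr_ge0// mulr_ge0 ?sqr_ge0// mulr_ge0// ltW.
- by rewrite divr_ge0 ?mulr_ge0// ltW.
- by move=> z /box[].
by move=> z /box[_ sz az]; apply: radial_weight_density_ge; rewrite ?s0.
Qed.
End density.

(** * Immersed tori in the sphere *)

Section immersion.
Context {R : realType}.
Variable f : R * R -> 'rV[R]_4.
Hypothesis immf : immersionS3 f.

Lemma immersion_Ck k : Ck k setT f.
Proof.
have [[U [g [oU sU gC gf]]] _ _ _] := immf.
have -> : f = g by apply/funext => x; rewrite gf.
(* The open neighbourhood of the whole plane is the plane itself. *)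
suff -> : [set: R * R] = U by exact: gC.
by apply/seteqP; split.
Qed.

Lemma immersion_continuous : continuous f.
Proof. by have [c _] := immersion_Ck 0 => x; exact: c. Qed.

Lemma immersion_partial i : continuous (partial i f) /\
  forall p, is_derive p (dir R i) f (partial i f p).
Proof.
have [_ /(_ (dir R i))[d [c _]]] := immersion_Ck 1.
split=> [p|p]; first exact: c.
by apply: derivableP; exact: d.
Qed.

Lemma immersion_partial2 i j : continuous (partial i (partial j f)) /\
  forall p, is_derive p (dir R i) (partial j f) (partial i (partial j f) p).
Proof.
have [_ /(_ (dir R j))[_ [_ /(_ (dir R i))[d [c _]]]]] := immersion_Ck 2.
split=> [p|p]; first exact: c.
by apply: derivableP; exact: d.
Qed.

(** Needed because the second fundamental form is built from both orders of
differentiation, and the first variation formula from one. *)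
Lemma partial_comm : partial 1 (partial 0 f) = partial 0 (partial 1 f).
Proof.
apply/funext => p; apply/rowP => i.
have cc (h : R * R -> 'rV[R]_4) : continuous h -> continuous (fun x => h x 0 i).
  by move=> ch q; apply: (@continuous_comp _ _ _ h (fun M => M 0 i));
    [exact: ch|exact: coord_continuous].
exact: (mixed_partials (fun q => is_derive_coord i ((immersion_partial 0).2 q))
  (fun q => is_derive_coord i ((immersion_partial 1).2 q))
  (fun q => is_derive_coord i ((immersion_partial2 1 0).2 q))
  (fun q => is_derive_coord i ((immersion_partial2 0 1).2 q))
  (cc _ (immersion_partial2 1 0).1) (cc _ (immersion_partial2 0 1).1)).
Qed.

Lemma immersion_grad : has_vgrad f (partial 0 f) (partial 1 f).
Proof.
have [c0 d0] := immersion_partial 0; have [c1 d1] := immersion_partial 1.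
by split; [exact: immersion_continuous|exact: c0|exact: c1|exact: d0|exact: d1].
Qed.

Lemma partial0_grad :
  has_vgrad (partial 0 f) (partial 0 (partial 0 f)) (partial 0 (partial 1 f)).
Proof.
have [c0 _] := immersion_partial 0; have [c00 d00] := immersion_partial2 0 0.
have [c10 d10] := immersion_partial2 1 0; rewrite -partial_comm.
by split; [exact: c0|exact: c00|exact: c10|exact: d00|exact: d10].
Qed.

Lemma partial1_grad :
  has_vgrad (partial 1 f) (partial 0 (partial 1 f)) (partial 1 (partial 1 f)).
Proof.
have [c0 _] := immersion_partial 1; have [c00 d00] := immersion_partial2 0 1.
have [c10 d10] := immersion_partial2 1 1.
by split; [exact: c0|exact: c00|exact: c10|exact: d00|exact: d10].
Qed.

Lemma jac_frame p : jac f p = frame (partial 0 f p) (partial 1 f p).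
Proof.
apply/matrixP => i j; rewrite [LHS]mxE [RHS]mxE.
by have [->|->] := ord2P i.
Qed.

Lemma frame_row_free p : row_free (frame (partial 0 f p) (partial 1 f p)).
Proof. by rewrite -jac_frame; have [_ _ _] := immf. Qed.

Lemma metric_frame p : metric f p =
  frame (partial 0 f p) (partial 1 f p) *m (frame (partial 0 f p) (partial 1 f p))^T.
Proof.
rewrite -jac_frame; apply/matrixP => i j; rewrite [LHS]mxE [RHS]mxE.
by apply: eq_bigr => k _; rewrite [in X in _ = X * _]mxE [in X in _ = _ * X]mxE
  [in X in _ = _ * X]mxE.
Qed.

Lemma sqrt_det_metric p : Num.sqrt (\det (metric f p)) =
  area_element (partial 0 f) (partial 1 f) p.
Proof. by rewrite metric_frame -gramE. Qed.

Lemma intmuE h : intmu f h =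
  square_integral (fun p => h p * area_element (partial 0 f) (partial 1 f) p).
Proof.
by rewrite /intmu /square_integral; apply: eq_Rintegral => p _; rewrite sqrt_det_metric.
Qed.

Lemma mul_tanproj p u : u *m tanproj f p = tangent_part (partial 0 f p) (partial 1 f p) u.
Proof.
by rewrite /tanproj metric_frame jac_frame mul_tangent_projection//; exact: frame_row_free.
Qed.

Lemma mul_norproj p u : u *m norproj f p =
  u - tangent_part (partial 0 f p) (partial 1 f p) u - dot u (f p) *: f p.
Proof.
rewrite /norproj !mulmxBr mulmx1 mul_tanproj mulmxA dotE.
by rewrite {1}(mx11_scalar (u *m (f p)^T)) mul_scalar_mx.
Qed.

Lemma dot_self p : dot (f p) (f p) = 1.
Proof.
have [_ _ /(_ p) + _] := immf; rewrite /enorm => h.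
by rewrite -(sqr_sqrtr (dot_ge0 (f p))) h expr1n.
Qed.

End immersion.

Section sphere.
Context {R : realType}.
Variables f f1 f2 f11 f12 f22 : R * R -> 'rV[R]_4.
Hypothesis hf : has_vgrad f f1 f2.
Hypothesis hf1 : has_vgrad f1 f11 f12.
Hypothesis hf2 : has_vgrad f2 f12 f22.
Hypothesis sphere : forall p, dot (f p) (f p) = 1.
Hypothesis free : forall p, row_free (frame (f1 p) (f2 p)).

Lemma has_grad_const0 (g g1 g2 : R * R -> R) c : has_grad g g1 g2 ->
  (forall p, g p = c) -> forall p, g1 p = 0 /\ g2 p = 0.
Proof.
move=> [_ _ _ d1 d2] /funext gc p; rewrite {}gc in d1 d2.
by split; [have <- := @derive_val _ _ _ _ _ _ _ (d1 p)|
  have <- := @derive_val _ _ _ _ _ _ _ (d2 p)]; rewrite derive_cst.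
Qed.

Lemma dot_partial p : dot (f1 p) (f p) = 0 /\ dot (f2 p) (f p) = 0.
Proof.
have [] := has_grad_const0 (has_grad_dot hf hf) sphere p.
by rewrite (dotC (f p) (f1 p)) (dotC (f p) (f2 p)) => ? ?; split; lra.
Qed.

(** Differentiating [<f, f> = 1] twice gives [<f_ij, f> = - <f_i, f_j>]; the
trace of the metric is 2. *)
Lemma dot_metric_laplacian p : dot (metric_laplacian f1 f2 f11 f12 f22 p) (f p) = - 2.
Proof.
have [a b] := has_grad_const0 (has_grad_dot hf1 hf) (fun q => (dot_partial q).1) p.
have [_ c] := has_grad_const0 (has_grad_dot hf2 hf) (fun q => (dot_partial q).2) p.
have D0 := lt0r_neq0 (gram_gt0 (free p)).
have {}a : dot (f11 p) (f p) = - dot (f1 p) (f1 p) by lra.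
have {}b : dot (f12 p) (f p) = - dot (f1 p) (f2 p) by lra.
have {}c : dot (f22 p) (f p) = - dot (f2 p) (f2 p) by lra.
by rewrite /metric_laplacian !dot_lin a b c /gram in D0 *; field.
Qed.

(** The curvature vector in R^4 is the one in the sphere, here [H], plus the
curvature [- 2 f] of the sphere itself. *)
Lemma curvature_vector_sqr p (H := metric_laplacian f1 f2 f11 f12 f22 p
    - tangent_part (f1 p) (f2 p) (metric_laplacian f1 f2 f11 f12 f22 p)
    - dot (metric_laplacian f1 f2 f11 f12 f22 p) (f p) *: f p) :
  dot (curvature_vector f1 f2 f11 f12 f22 p) (curvature_vector f1 f2 f11 f12 f22 p) =
    dot H H + 4.
Proof.
have [a b] := dot_partial p.
have : dot (curvature_vector f1 f2 f11 f12 f22 p) (f p) = - 2.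
  by rewrite /curvature_vector dotBl dot_metric_laplacian dot_tangent_part a b; ring.
have -> : H = curvature_vector f1 f2 f11 f12 f22 p + 2 *: f p.
  by rewrite /H dot_metric_laplacian scaleNr opprK.
move: (curvature_vector _ _ _ _ _ p) => c cf.
by rewrite !dot_lin (dotC (f p) c) cf sphere; ring.
Qed.
End sphere.

Lemma trace_frame_sqr {R : realType} (x y : 'rV[R]_4) (a : 'I_2 -> 'I_2 -> 'rV[R]_4)
    (N : 'M[R]_4) : row_free (frame x y) -> a 1 0 = a 0 1 ->
  \sum_(i < 2) \sum_(j < 2) invmx (frame x y *m (frame x y)^T) i j *: (a i j *m N) =
  ((gram x y)^-1 *: (dot y y *: a 0 0 - (2 * dot x y) *: a 0 1 + dot x x *: a 1 1)) *m N.
Proof.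
move=> free a10; rewrite invmx_frame_sqr// sum_ord2 !sum_ord2 !mxE/= a10.
rewrite !scalemxAl -!mulmxDl; congr (_ *m _).
move: (a 0 0) (a 0 1) (a 1 1) => u v w.
by apply/rowP => i; rewrite !mxE; ring.
Qed.

Section willmore.
Context {R : realType}.
Variable f : R * R -> 'rV[R]_4.
Hypothesis immf : immersionS3 f.

Lemma meancurvE p (h := metric_laplacian (partial 0 f) (partial 1 f)
  (partial 0 (partial 0 f))
    (partial 0 (partial 1 f)) (partial 1 (partial 1 f)) p) :
  meancurv f p = h - tangent_part (partial 0 f p) (partial 1 f p) h - dot h (f p) *: f p.
Proof.
apply: etrans (mul_norproj immf p h).
have := @trace_frame_sqr _ _ _ (fun i j => partial i (partial j f) p) (norproj f p)
  (frame_row_free immf p) (congr1 (fun g => g p) (partial_comm immf)).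
by rewrite -metric_frame.
Qed.

Lemma willmoreE : willmore f = 4^-1 * square_integral (fun p =>
  dot (curvature_vector (partial 0 f) (partial 1 f) (partial 0 (partial 0 f))
    (partial 0 (partial 1 f)) (partial 1 (partial 1 f)) p)
   (curvature_vector (partial 0 f) (partial 1 f) (partial 0 (partial 0 f))
    (partial 0 (partial 1 f)) (partial 1 (partial 1 f)) p)
  * area_element (partial 0 f) (partial 1 f) p).
Proof.
have hf1 := partial0_grad immf; have hf2 := partial1_grad immf.
have free := frame_row_free immf.
rewrite -square_integralZ; last first.
  apply: (continuous_mul _ (continuous_area_element hf1 hf2)).
  by apply: continuous_dot; exact: continuous_curvature_vector.
rewrite /willmore intmuE//; congr square_integral; apply/funext => p.
rewrite (curvature_vector_sqr (immersion_grad immf) hf1 hf2 (dot_self immf) free).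
by rewrite -meancurvE mulrA; congr (_ * _); field.
Qed.
End willmore.

(** * Many separated points cost energy *)

(** Among the values at one point of functions with disjoint supports, at most
one is nonzero. *)
Lemma sum_exclusive_le {R : realType} n (a : 'I_n -> R) (M : R) : 0 <= M ->
  (forall k l, a k != 0 -> a l != 0 -> k = l) ->
  (forall k, a k != 0 -> a k <= M) -> \sum_(k < n) a k <= M.
Proof.
move=> M0 excl aM; have [/existsP[k ak]|/existsPn a0] := boolP [exists k, a k != 0].
  rewrite (bigD1 k)//= big1 ?addr0; first exact: aM.
  move=> l; apply: contraNeq => al; exact/eqP/excl.
by rewrite big1// => k _; apply/eqP; have := a0 k; rewrite negbK.
Qed.

Section packing.
Context {R : realType}.
Variable f : R * R -> 'rV[R]_4.
Hypothesis immf : immersionS3 f.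
Local Notation dA := (area_element (partial 0 f) (partial 1 f)).
Local Notation H := (curvature_vector (partial 0 f) (partial 1 f) (partial 0 (partial 0 f))
    (partial 0 (partial 1 f)) (partial 1 (partial 1 f))).

(** Adds up the local inequalities at the points [P k].  The cutoffs have
disjoint supports and are bounded by 1, so the curvature terms add up to at most
the total energy, and the area terms to at most the integral of [phi]. *)
Lemma packing_bound n (P : 'I_n -> R * R) (r : R) (phi : 'rV[R]_4 -> R) :
  0 < r -> (forall k, 0 < (P k).1 < 1 /\ 0 < (P k).2 < 1) ->
  (forall k l, k != l -> 2 * r <= `|f (P k) - f (P l)|) ->
  continuous phi -> (forall y, 0 <= phi y) ->
  (forall k y, `|y - f (P k)| < r -> 1 <= phi y) ->
  n%:R / 36 <= willmore f / 2 + 4 / r ^+ 2 * intmu f (fun p => phi (f p)).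
Proof.
move=> r0 Pin Psep cphi phi0 phi1.
have hf := immersion_grad immf.
have hf1 := partial0_grad immf; have hf2 := partial1_grad immf.
have free := frame_row_free immf.
have per : Defs.periodic f by have [] := immf.
have rho0 : 0 < r ^+ 2 by rewrite exprn_gt0.
have cf := immersion_continuous immf.
pose s k p := dot (f p - f (P k)) (f p - f (P k)).
have cs k : continuous (s k).
  have cu : continuous (fun p => f p - f (P k)).
    exact: continuous_vsub_cst.
  exact: (continuous_dot cu cu).
have cA : continuous dA := continuous_area_element hf1 hf2.
have cH : continuous H := continuous_curvature_vector hf1 hf2 free.
have cN := continuous_mul (continuous_dot cH cH) cA.
have cphif : continuous (fun p => phi (f p)).
  by move=> p; apply: (@continuous_comp _ _ _ f phi); [exact: cf|exact: cphi].
have local k : 36^-1 <=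
    8^-1 * square_integral (fun p => cutoff (r ^+ 2) (s k p) * (dot (H p) (H p) * dA p)) +
    4 / r ^+ 2 * square_integral (fun p => ramp (r ^+ 2) (s k p) * dA p).
  have [p1 p2] := Pin k.
  have [e e0 He] := density_bound hf hf1 hf2 free p1 p2 rho0.
  exact: le_trans He (energy_inequality hf hf1 hf2 per free (f (P k)) rho0 e0).
have A0 p : 0 <= dA p by rewrite ltW// area_element_gt0.
have near_k k p : ramp (r ^+ 2) (s k p) != 0 -> `|f p - f (P k)| < r.
  move=> rf; rewrite ltNge; apply: contra rf => rf; apply/eqP/ramp_eq0 => //.
  apply: le_trans (sqr_norm_le_dot _).
  by rewrite lerXn2r ?nnegrE ?normr_ge0// ltW.
have excl p k l : ramp (r ^+ 2) (s k p) != 0 -> ramp (r ^+ 2) (s l p) != 0 -> k = l.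
  move=> /near_k pk /near_k pl; apply/eqP/negPn/negP => /Psep.
  apply/negP; rewrite -ltNge.
  have -> : f (P k) - f (P l) = (f p - f (P l)) - (f p - f (P k))
    by rewrite opprB [RHS]addrC addrA subrK.
  by apply: le_lt_trans (ler_normB _ _) _; lra.
have s0 k p : 0 <= s k p by exact: dot_ge0.
have ccut k : continuous (fun p => cutoff (r ^+ 2) (s k p) * (dot (H p) (H p) * dA p)).
  exact: (continuous_mul (continuous_cutoff (cs k)) cN).
have cramp k : continuous (fun p => ramp (r ^+ 2) (s k p) * dA p).
  exact: (continuous_mul (continuous_ramp (cs k)) cA).
have -> : n%:R / 36 = \sum_(k < n) (36^-1 : R) by rewrite sumr_const card_ord mulr_natl.
apply: le_trans (ler_sum _ (fun k _ => local k)) _.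
rewrite big_split/= -!mulr_sumr -!square_integral_sum//.
apply: lerD.
  have -> : willmore f / 2 = 8^-1 * square_integral (fun p => dot (H p) (H p) * dA p).
    by rewrite willmoreE//; field.
  rewrite ler_pM2l//; apply: square_integral_le => //; first exact: (continuous_sum ccut).
  move=> p; rewrite -mulr_suml ler_piMl ?mulr_ge0 ?dot_ge0//.
  apply: sum_exclusive_le => // [k l|k _].
    by rewrite !cutoffE !sqrf_eq0; exact: excl.
  by rewrite cutoffE expr_le1// ?ramp_ge0// ramp_le1.
rewrite ler_pM2l ?divr_gt0// intmuE//; apply: square_integral_le.
- exact: (continuous_sum cramp).
- exact: (continuous_mul cphif cA).
move=> p; rewrite -mulr_suml ler_wpM2r//.
apply: sum_exclusive_le => [||k kp]; [exact: phi0|by move=> k l; exact: excl|].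
by apply: le_trans (phi1 k _ (near_k _ _ kp)); rewrite ramp_le1.
Qed.
End packing.

(** * Monotonicity of the Willmore energy along the flow *)

Section Ck.
Context {R : realType} {V W : normedModType R}.

(** Restriction to a fixed time, which makes the velocity of the flow a smooth
field on the torus. *)
Lemma Ck_slice k (U : set (R * V)) (h : R * V -> W) t : Ck k U h ->
  Ck k [set p | U (t, p)] (fun p => h (t, p)).
Proof.
have ct p : {for p, continuous (fun p : V => (t, p))}.
  by apply: (@cvg_pair _ _ _ (nbhs p) (nbhs t) (nbhs p) _ _ _ (cst t) id);
    [exact: cvg_cst|exact: cvg_id].
have E g v p : (fun a : R => a^-1 *: (g (t, a *: v + p) - g (t, p))) =
    (fun a : R => a^-1 *: (g (a *: ((0, v) : R * V) + (t, p)) - g (t, p))) :> (R -> W).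
  apply/funext => a; have -> : a *: ((0, v) : R * V) + (t, p) = (a *: 0 + t, a *: v + p)
    by [].
  by rewrite scaler0 add0r.
elim: k h => [|k IH] h /= [ch dh].
  by split => // p Up; apply: (@continuous_comp _ _ _ (fun p => (t, p)) h);
    [exact: ct|exact: ch].
split=> [p Up|v].
  by apply: (@continuous_comp _ _ _ (fun p => (t, p)) h); [exact: ct|exact: ch].
have [d C] := dh (0, v); split=> [p Up|].
  by have := d _ Up; rewrite /derivable/= E.
have -> : (fun x => 'D_v (fun p => h (t, p)) x) = (fun x => 'D_(0, v) h (t, x)).
  by apply/funext => p; rewrite /derive/= E.
exact: (IH _ C).
Qed.

Lemma Ck_translate k (U : set V) (h : V -> W) c : Ck k U h ->
  Ck k [set z | U (z + c)] (fun z => h (z + c)).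
Proof.
have ct z : {for z, continuous (fun z : V => z + c)}.
  by apply: cvgD; [exact: cvg_id|exact: cvg_cst].
have E g v z : (fun a : R => a^-1 *: (g (a *: v + z + c) - g (z + c))) =
    (fun a : R => a^-1 *: (g (a *: v + (z + c)) - g (z + c))) :> (R -> W).
  by apply/funext => a; rewrite addrA.
elim: k h => [|k IH] h /= [ch dh].
  by split => // p Up; apply: (@continuous_comp _ _ _ (fun z => z + c) h);
    [exact: ct|exact: ch].
split=> [p Up|v].
  by apply: (@continuous_comp _ _ _ (fun z => z + c) h); [exact: ct|exact: ch].
have [d C] := dh v; split=> [p Up|].
  by have := d _ Up; rewrite /derivable/= E.
have -> : (fun x => 'D_v (fun z => h (z + c)) x) = (fun x => 'D_v h (x + c)).
  by apply/funext => p; rewrite /derive/= E.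
exact: (IH _ C).
Qed.
End Ck.

Section flow.
Context {R : realType}.
Variables (T : R) (F : R -> R * R -> 'rV[R]_4).
Hypothesis flow : miwf T F.

(** The flow started at time [t] is itself a variation of [F t] by immersions,
with velocity [- |A^0|^-4 G]; the definition of the gradient then gives the
derivative [- integral of |A^0|^-4 |G|^2]. *)
Lemma willmore_derive t : 0 < t < T ->
  exists2 D, is_derive t (1 : R) (fun s => willmore (F s)) D & D <= 0.
Proof.
move=> /andP[t0 tT].
have [T0 [U [g [oU sU gC gF]]] imm eqn] := flow.
have tin : 0 <= t < T by rewrite ltW.
have [immt _] := imm t tin.
have [G [[Gsm Gper Gorth] Ggrad] Geq] := eqn t tin.
have small c : 0 < c -> \forall e \near (0 : R), `|e| < c.
  by move=> c0; exists c => // z; rewrite /= sub0r normrN.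
have Ut p : U (t, p) by exact: sU.
pose v0 : R * (R * R) := (1, 0).
pose phi p := 'D_v0 g (t, p).
have nearF p : \forall e \near (0 : R), g (t + e, p) = F (t + e) p.
  near=> e; apply: (gF (t + e, p)); rewrite /=.
  have et : `|e| < t by near: e; exact: small.
  have eT : `|e| < T - t by near: e; apply: small; rewrite subr_gt0.
  move: et eT; rewrite !ltr_norml => /andP[? ?] /andP[? ?].
  by apply/andP; split; lra.
have dphi p : is_derive (0 : R) (1 : R) (fun e => F (t + e) p) (phi p).
  apply: near_eq_is_derive (nearF p) _.
  have [_ /(_ v0)[d _]] := gC 1.
  have := derivableP (d _ (Ut p)) => /is_derive_line.
  congr (is_derive _ _ _ _); apply/funext => h.
  have -> : h *: v0 + (t, p) = (h *: 1 + t, h *: 0 + p) by [].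
  by rewrite scaler0 add0r [h *: 1]mulr1 addrC.
(* The flow equation is stated with a right derivative, which agrees with the
   two-sided one since the flow extends smoothly to an open set of times. *)
have phiE p : phi p = - (sff0_sq (F t) p ^- 2 *: G p).
  have [d <-] := dphi p.
  have h1 : h^-1 *: (F (t + h) p - F t p) @[h --> (0 : R)^'] -->
      'D_1 (fun e => F (t + e) p) (0 : R).
    move: d; rewrite /derivable /derive/=.
    have -> : (fun h : R => h^-1 *: (F (t + (h *: 1 + 0)) p - F (t + 0) p)) =
              (fun h : R => h^-1 *: (F (t + h) p - F t p)).
      by apply/funext => h; rewrite !addr0 [h *: 1]mulr1.
    by [].
  exact: (cvg_unique _ (cvg_dnbhs_at_right h1) (Geq p)).
have nphi : normal_field (F t) phi.
  split.
  - exists setT, phi; split => //; first exact: openT.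
    move=> k; have [_ /(_ v0)[_ C]] := gC k.+1.
    have := Ck_slice t C; congr (Ck _ _ _).
    by apply/seteqP; split => // p _; exact: Ut.
  - have shift p c : (forall s, 0 <= s < T -> F s (p + c) = F s p) -> phi (p + c) = phi p.
      move=> Fc; have [_ <-] := dphi (p + c); have [_ <-] := dphi p.
      apply: near_eq_derive; near=> e.
      have et : `|e| < t by near: e; exact: small.
      have eT : `|e| < T - t by near: e; apply: small; rewrite subr_gt0.
      move: et eT; rewrite !ltr_norml => /andP[? ?] /andP[? ?].
      by apply: Fc; apply/andP; split; lra.
    have E1 x y : (x + 1, y) = (x, y) + (1, 0) :> R * R by congr pair; rewrite /= addr0.
    have E2 x y : (x, y + 1) = (x, y) + (0, 1) :> R * R by congr pair; rewrite /= addr0.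
    move=> x y; rewrite E1 E2; split; apply: shift => s sT; rewrite -?E1 -?E2;
      have [[_ ps _ _] _] := imm s sT; by have [] := ps x y.
  - move=> p; have [G1 G2] := Gorth p; rewrite phiE !dotNl dotZl G1 mulr0 oppr0.
    by split => // i; rewrite dotNl dotZl G2 mulr0 oppr0.
pose d := Num.min t (T - t).
have d0 : 0 < d by rewrite lt_min t0 subr_gt0.
have din e : - d < e < d -> 0 <= t + e < T.
  have [dt dT] : d <= t /\ d <= T - t by rewrite /d !ge_min !lexx orbT.
  by move=> /andP[? ?]; apply/andP; split; lra.
have var : Defs.variation (F t) phi (fun e => F (t + e)).
  exists d; first exact: d0.
  split.
  - exists [set z | U (z + (t, 0))], (fun z => g (z + (t, 0))); split.
    + have : continuous (fun z : R * (R * R) => z + (t, 0)).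
        by move=> z; apply: cvgD; [exact: cvg_id|exact: cvg_cst].
      by move=> /continuousP; apply.
    + move=> [e p] /= /din ein; apply: sU.
      by have -> : (e, p) + (t, 0) = (t + e, p) by congr pair; rewrite /= ?addr0// addrC.
    + by move=> k; exact: Ck_translate.
    + move=> [e p] /= /din ein.
      have -> : (e, p) + (t, 0) = (t + e, p) by congr pair; rewrite /= ?addr0// addrC.
      exact: (gF (t + e, p)).
  - by move=> e /din /imm[].
  - by move=> p; rewrite addr0.
  - exact: dphi.
have W' := Ggrad _ _ nphi var.
set D := intmu _ _ in W'.
have L : is_derive t (1 : R) (fun s => willmore (F s)) D.
  exact: (is_derive_translate (u := fun s => willmore (F s)) W').
exists D; first exact: L.
rewrite /D.
rewrite -oppr_ge0 intmuE//.
have -> : - square_integral (fun p =>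
      dot (G p) (phi p) * area_element (partial 0 (F t)) (partial 1 (F t)) p) =
    - square_integral (fun p => - (sff0_sq (F t) p ^- 2 * dot (G p) (G p) *
      area_element (partial 0 (F t)) (partial 1 (F t)) p)).
  by congr (- square_integral _); apply/funext => p; rewrite phiE dotNr dotZr mulNr.
have pos p : 0 <= sff0_sq (F t) p ^- 2 * dot (G p) (G p) *
    area_element (partial 0 (F t)) (partial 1 (F t)) p.
  by rewrite !mulr_ge0 ?dot_ge0 ?sqrtr_ge0// invr_ge0 sqr_ge0.
rewrite /square_integral /Rintegral.
under eq_integral do rewrite EFinN.
rewrite integral_ge0N; last by move=> p _; rewrite lee_fin.
by rewrite fineN opprK fine_ge0// integral_ge0// => p _; rewrite lee_fin.
Unshelve. all: by end_near. Qed.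

Lemma willmore_nonincreasing s t : 0 < s -> s <= t -> t < T ->
  willmore (F t) <= willmore (F s).
Proof.
move=> s0 st tT.
have D x : s / 2 < x < (t + T) / 2 ->
    exists2 D, is_derive x (1 : R) (fun s => willmore (F s)) D & D <= 0.
  by move=> /andP[? ?]; apply: willmore_derive; apply/andP; split; lra.
apply: (@ler0_derive1_nincr _ (fun s => willmore (F s)) s t) => //.
- move=> x; rewrite in_itv/= => /andP[? ?].
  by have [d [dx _] _] := D x ltac:(apply/andP; split; lra).
- move=> x; rewrite in_itv/= => /andP[? ?].
  have [d [dx e] d0] := D x ltac:(apply/andP; split; lra).
  by rewrite derive1E e.
apply: continuous_in_subspaceT => x; rewrite inE/= in_itv/= => /andP[? ?].
apply/differentiable_continuous/derivable1_diffP.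
by have [d [dx _] _] := D x ltac:(apply/andP; split; lra).
Qed.
End flow.

(** * Test functions on the Grassmann bundle and the support *)

Section grassmannian.
Context {R : realType}.

(** For an orthogonal projection [P i i] is the squared length of row [i], so
it bounds its own square.  Hence the Grassmannian is bounded, and a test function
of the point alone has compact support in the Grassmann bundle. *)
Lemma projection_entry_le1 (P : 'M[R]_4) : planes R P -> forall i j, `|P i j| <= 1.
Proof.
move=> [PT PP _] i j.
have Pii : P i i = \sum_k P i k ^+ 2.
  by rewrite -{1}PP mxE; apply: eq_bigr => k _; rewrite expr2 -[in P k i]PT mxE.
have le k : P i k ^+ 2 <= P i i.
  by rewrite Pii (bigD1 k)//= lerDl sumr_ge0// => l _; exact: sqr_ge0.
have Pii0 : 0 <= P i i by rewrite Pii sumr_ge0// => l _; exact: sqr_ge0.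
have Pii1 : P i i <= 1.
  have [->|P0] := eqVneq (P i i) 0; first exact: ler01.
  by have := le i; rewrite expr2 ger_pMl// lt_def P0.
rewrite -(ler_pXn2r (n := 2))// ?nnegrE// expr1n real_normK ?num_real//.
exact: le_trans (le j) Pii1.
Qed.

(** The rank of an idempotent is visible in its trace, which is continuous
whereas the rank is not; this makes the Grassmannian closed. *)
Lemma idempotent_trace (P : 'M[R]_4) : P *m P = P -> \tr P = (\rank P)%:R.
Proof.
move=> PP.
have [B' BB'] := row_freeP (row_base_free P).
have [C' C'C] := row_fullP (col_base_full P).
move: (row_base P) (col_base P) (mulmx_base P) BB' C'C => B C CB BB' C'C.
have BC : B *m C = 1%:M.
  have : C *m (B *m C) *m B = C *m B by rewrite !mulmxA -[_ *m C *m B]mulmxA CB.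
  move=> /(congr1 (fun M => C' *m M *m B')).
  by rewrite !mulmxA C'C mul1mx -!mulmxA BB' !mulmx1.
by rewrite -{1}CB mxtrace_mulC BC mxtrace1.
Qed.

Lemma planesE : planes R =
  [set P | P^T = P] `&` [set P | P *m P = P] `&` [set P | \tr P = 2].
Proof.
apply/seteqP; split=> P.
  by move=> [PT PP Pr]; split=> //=; rewrite idempotent_trace// Pr.
move=> [[PT PP]] /= Ptr; split=> //; have := idempotent_trace PP; rewrite Ptr.
by move=> /eqP; rewrite eqr_nat => /eqP.
Qed.

Lemma closed_planes : closed (planes R).
Proof.
have closed_entries (g h : 'M[R]_4 -> 'M[R]_4) :
    (forall i j, continuous (fun P => g P i j)) ->
      (forall i j, continuous (fun P => h P i j)) ->
    closed [set P | g P = h P].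
  move=> cg ch.
  have -> : [set P | g P = h P] =
      \bigcap_i \bigcap_j ((fun P => g P i j - h P i j) @^-1` [set 0]).
    apply/seteqP; split=> P /= E; first by move=> i _ j _ /=; rewrite E subrr.
    apply/matrixP => i j; have := E i I j I => /eqP; rewrite subr_eq0 => /eqP; exact.
  apply: closed_bigI => i _; apply: closed_bigI => j _.
  apply: closed_comp => [P _|]; last exact: closed_eq.
  exact: (continuous_sub (cg i j) (ch i j)).
have cid i j : continuous (fun P : 'M[R]_4 => P i j) by exact: coord_continuous.
rewrite planesE; apply: closedI; first apply: closedI.
- by apply: closed_entries => // i j; under eq_fun do rewrite mxE; exact: cid.
- apply: closed_entries => // i j.
  under eq_fun do rewrite mxE.
  apply: continuous_big => [|k _]; first exact: add_continuous.
  exact: (continuous_mul (cid i k) (cid k j)).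
have -> : [set P : 'M[R]_4 | \tr P = 2] = (fun P : 'M[R]_4 => \tr P) @^-1` [set 2] by [].
apply: closed_comp => [P _|]; last exact: closed_eq.
apply: (@continuous_big _ _ +%R 0 xpredT _ _ _ (fun i (P : 'M[R]_4) => P i i)) => [|i _].
  exact: add_continuous.
exact: cid.
Qed.

Lemma compact_unit_matrices : compact [set P : 'M[R]_4 | forall i j, `|P i j| <= 1].
Proof.
have cbox : compact [set v : 'rV[R]_(4 * 4) | forall i, v ord0 i \in `[-1, 1]].
  exact: (@rV_compact R (4 * 4)%N (fun=> `[-1, 1]%classic : set R)
    (fun _ => @segment_compact R _ _)).
have cvec : continuous (fun v : 'rV[R]_(4 * 4) => vec_mx v : 'M[R]_4).
  move=> v A /nbhs_ballP[e /= e0 eA]; apply/nbhs_ballP; exists e => // w [_ vw].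
  by apply: eA; split => // i j; rewrite !mxE; exact: vw.
have -> : [set P : 'M[R]_4 | forall i j, `|P i j| <= 1] =
    vec_mx @` [set v : 'rV[R]_(4 * 4) | forall i, v ord0 i \in `[-1, 1]].
  apply/seteqP; split=> P /=.
    move=> P1; exists (mxvec P); last exact: mxvecK.
    by move=> k; case/mxvec_indexP: k => i j; rewrite mxvecE in_itv/= -ler_norml.
  move=> [v v1 <-] i j; rewrite mxE ler_norml.
  by have := v1 (mxvec_index i j); rewrite in_itv.
by apply: continuous_compact => //; exact: continuous_subspaceT.
Qed.
End grassmannian.

Section varifold.
Context {R : realType}.
Local Notation pair := ('rV[R]_4 * 'M[R]_4)%type.
Variable V : {measure set (borel_pair R) -> \bar R}.
Hypothesis varV : varifold V.

Lemma open_measurable_pair (U : set pair) : open U ->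
  measurable (U : set (borel_pair R)).
Proof. by move=> oU; exact: sub_sigma_algebra. Qed.

Lemma closed_measurable_pair (U : set pair) : closed U ->
  measurable (U : set (borel_pair R)).
Proof.
move=> cU; rewrite -(setCK (U : set (borel_pair R))); apply: measurableC.
exact: (open_measurable_pair (closed_openC cU)).
Qed.

Lemma fst_continuous : continuous (fun z : pair => z.1).
Proof. by move=> z; exact: cvg_fst. Qed.

Lemma measurable_grass2 : measurable (grass2 R : set (borel_pair R)).
Proof.
apply: closed_measurable_pair; apply: (@closed_comp _ _ snd); last exact: closed_planes.
by move=> z _; exact: cvg_snd.
Qed.

Lemma measurable_cylinder_open (B : set 'rV[R]_4) : open B ->
  measurable ([set z | B z.1] : set (borel_pair R)).
Proof.
move=> oB; apply: open_measurable_pair.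
by move/continuousP: fst_continuous; apply.
Qed.

Lemma continuous_measurable_cylinder (phi : 'rV[R]_4 -> R) : continuous phi ->
  measurable_fun setT (fun z : borel_pair R => phi z.1).
Proof.
move=> cphi; apply: (measurability _ (RGenOpens.measurableE R)).
move=> _ [_ [a [b ->] <-]]; rewrite setTI.
apply: (measurable_cylinder_open (B := phi @^-1` `]a, b[%classic)).
by move/continuousP: cphi; apply; exact: interval_open.
Qed.

(** Every point outside the support has a neighbourhood of weight zero, and
finitely many of these cover a compact set. *)
Lemma negligible_compact (K : set 'rV[R]_4) : compact K ->
  (forall y, K y -> ~ spt V y) -> V.-negligible [set z | K z.1].
Proof.
move=> cK Kspt.
have /choice[U UP] : forall y, exists U : set 'rV[R]_4, K y ->
    [/\ open U, U y & weight V U = 0%E].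
  move=> y; have [Ky|nKy] := pselect (K y); last by exists setT.
  have /existsNP[U /not_implyP[oU /not_implyP[Uy /negP]]] := Kspt y Ky.
  by rewrite negbK => /eqP w0; exists U.
move: cK; rewrite compact_cover => /(_ _ K U)[||D' D'K KU].
- by move=> y /UP[].
- by move=> y Ky; exists y => //; have [] := UP y Ky.
pose C y : set (borel_pair R) := [set z | U y z.1].
have KC : ([set z | K z.1] : set (borel_pair R)) `<=`
    \big[setU/set0]_(y <- finmap.enum_fset D') C y.
  by move=> z /KU[y D'y Uy]; rewrite -bigcup_seq; exists y.
apply: (negligibleS KC).
rewrite big_seq; elim/big_ind : _ => [||y yD'].
- exact: negligible_set0.
- by move=> A B; exact: negligibleU.
have [oU _ w0] := UP y (set_mem (D'K y yD')).
by apply/negligibleP => //; exact: measurable_cylinder_open.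
Qed.

Lemma compact_norm_le (M : R) : compact [set y : 'rV[R]_4 | `|y| <= M].
Proof.
apply: bounded_closed_compact.
  by exists M; split => [|x Mx y /= yM]; [exact: num_real|exact: le_trans yM (ltW Mx)].
have -> : [set y : 'rV[R]_4 | `|y| <= M] =
    (fun y : 'rV[R]_4 => `|y|) @^-1` [set x | x <= M] by [].
by apply: closed_comp => [y _|]; [exact: norm_continuous|exact: closed_le].
Qed.

Definition cylinder (M : R) : set pair :=
  [set y : 'rV[R]_4 | `|y| <= M] `*` [set P : 'M[R]_4 | forall i j, `|P i j| <= 1].

Lemma compact_cylinder (M : R) : compact (cylinder M).
Proof.
by apply: compact_setX; [exact: compact_norm_le|exact: compact_unit_matrices].
Qed.

Section test_function.
Variables (phi : 'rV[R]_4 -> R) (M : R).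
Hypothesis cphi : continuous phi.
Hypothesis phi_supp : forall y, M < `|y| -> phi y = 0.

(** The fibres of the Grassmann bundle are compact, so a test function on R^4
may be used as a test function on the bundle. *)
Lemma cylinder_Cc_grass2 : Cc_grass2 (fun z : pair => phi z.1).
Proof.
split.
  apply: continuous_subspaceT => z.
  by apply: (@continuous_comp _ _ _ fst phi); [exact: fst_continuous|exact: cphi].
exists (cylinder M).
  exact: compact_cylinder.
move=> [y P] /= gP yP; apply: phi_supp; rewrite ltNge; apply/negP => yM; apply: yP.
by split => //=; exact: projection_entry_le1.
Qed.

Let mphi (D : set (borel_pair R)) : measurable_fun D (fun z : borel_pair R => (phi z.1)%:E).
Proof.
apply: measurable_funTS; apply/measurable_EFinP.
exact: continuous_measurable_cylinder.
Qed.

Lemma integral_cylinder_eq0 (K : set 'rV[R]_4) : compact K ->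
  (forall y, K y -> ~ spt V y) -> (forall y, phi y != 0 -> K y) ->
  \int[V]_(z in grass2 R) phi z.1 = 0.
Proof.
move=> cK Kspt phiK; rewrite /Rintegral.
rewrite (@ae_eq_integral _ _ _ V (grass2 R) (cst 0%E))//.
- by rewrite integral0.
- exact: measurable_grass2.
apply: (negligibleS _ (negligible_compact cK Kspt)) => z /= /not_implyP[_ nz].
by apply: phiK; apply/eqP => p0; apply: nz; rewrite p0.
Qed.

Lemma negligible_Ngrass2 : V.-negligible (~` (grass2 R : set (borel_pair R))).
Proof.
have [v0 _] := varV; apply/negligibleP => //.
by apply: measurableC; exact: measurable_grass2.
Qed.

(** The upper bound on [phi] and its bounded support make the integral finite; an
infinite integral would have the real value 0 by convention. *)
Lemma integral_cylinder_gt0 x (B : set 'rV[R]_4) (c : R) : spt V x -> open B -> B x ->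
  0 < c -> (forall y, 0 <= phi y <= 1) -> (forall y, B y -> c <= phi y) ->
  0 < \int[V]_(z in grass2 R) phi z.1.
Proof.
move=> sx oB Bx c0 phi01 cphiB.
have phi0 (z : borel_pair R) : (0 <= (phi z.1)%:E)%E by rewrite lee_fin;
  case/andP: (phi01 z.1).
have mg := measurable_grass2.
pose C : set (borel_pair R) := [set z | B z.1].
have mC : measurable C by exact: measurable_cylinder_open.
have mgC : measurable ((grass2 R : set (borel_pair R)) `&` C) by exact: measurableI.
pose K : set (borel_pair R) := cylinder M.
have mK : measurable K.
  apply: closed_measurable_pair; apply: compact_closed; last exact: compact_cylinder.
  exact: norm_hausdorff.
rewrite /Rintegral; apply: fine_gt0; apply/andP; split.
  apply: (@lt_le_trans _ _ (\int[V]_(z in (grass2 R : set (borel_pair R)) `&` C) c%:E)%E).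
    rewrite integral_cst//= mule_gt0 ?lte_fin// lt0e measure_ge0 andbT.
    apply/eqP => V0; have := sx B oB Bx; rewrite /weight => /eqP; apply.
    have : V.-negligible C.
      apply: (negligibleS _ (negligibleU ((negligibleP V mgC).2 V0) negligible_Ngrass2)).
      by move=> z Cz; have [gz|gz] := pselect ((grass2 R : set (borel_pair R)) z);
        [left|right].
    by move=> /negligibleP; exact.
  apply: (@le_trans _ _ (\int[V]_(z in (grass2 R : set (borel_pair R)) `&` C)
    (phi z.1)%:E)%E).
    apply: ge0_le_integral => //.
    - by move=> z _; rewrite lee_fin ltW.
    - by move=> z [_ Bz]; rewrite lee_fin cphiB.
  by apply: ge0_subset_integral => //; exact: subIsetl.
apply: (@le_lt_trans _ _ (\int[V]_(z in grass2 R) (\1_K z)%:E)%E).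
  apply: ge0_le_integral => //.
  - by apply: measurable_funTS; apply/measurable_EFinP; exact: measurable_indic.
  move=> z gz; rewrite lee_fin indicE; case: (boolP (z \in K)) => zK.
    by case/andP: (phi01 z.1).
  rewrite phi_supp// ltNge; apply/negP => zM; move/negP: zK; apply.
  by rewrite inE; split => //=; exact: projection_entry_le1.
rewrite integral_indic//; apply: (@le_lt_trans _ _ (V K)).
  by apply: le_measure; rewrite ?inE//; exact: measurableI.
by have [_] := varV; apply; exact: compact_cylinder.
Qed.
End test_function.

Lemma spt_closed : closed (spt V).
Proof.
rewrite -[spt V]setCK; apply: open_closedC; rewrite openE => y.
move=> /existsNP[U /not_implyP[oU /not_implyP[Uy /negP]]]; rewrite negbK => w0.
apply: (filterS _ (open_nbhs_nbhs (conj oU Uy))) => z Uz /(_ U oU Uz).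
by rewrite w0.
Qed.

Lemma spt_nonempty : V setT != 0%E -> spt V !=set0.
Proof.
move=> V0; apply/set0P/negP => /eqP s0; move/eqP: V0; apply.
apply: measure_negligible => //.
(* Were the support empty, the whole bundle would be a countable union of
   null sets. *)
have -> : [set: borel_pair R] = \bigcup_n [set z | `|z.1| <= n%:R].
  apply/seteqP; split => // -[y P] _.
  exists (Num.trunc `|y|).+1 => //=; exact/ltW/truncnS_gt.
apply: negligible_bigcup => n.
apply: (negligible_compact (K := [set y | `|y| <= n%:R])); first exact: compact_norm_le.
by move=> y _; rewrite s0.
Qed.
End varifold.

(** * Distance to a set and intermediate values on the torus *)

Section distance.
Context {R : realType}.
Variable S : set 'rV[R]_4.
Hypothesis S0 : S !=set0.

(** Distance in the sup norm; it is equivalent to the Euclidean norm, so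
either may be used for Hausdorff convergence. *)
Definition dist_to (y : 'rV[R]_4) : R := inf [set `|y - z| | z in S].

Let dist_lb y : has_lbound [set `|y - z| | z in S].
Proof. by exists 0 => _ [z _ <-]; exact: normr_ge0. Qed.

Lemma dist_to_le y z : S z -> dist_to y <= `|y - z|.
Proof. by move=> Sz; apply: ge_inf; [exact: dist_lb|exists z]. Qed.

Lemma le_dist_to y (c : R) : (forall z, S z -> c <= `|y - z|) -> c <= dist_to y.
Proof.
move=> cle; apply: lb_le_inf; last by move=> _ [z Sz <-]; exact: cle.
by have [z Sz] := S0; exists `|y - z|; exists z.
Qed.

Lemma dist_to_lip y y' : dist_to y - dist_to y' <= `|y - y'|.
Proof.
rewrite lerBlDl -lerBlDr; apply: le_dist_to => z Sz; rewrite lerBlDr.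
apply: le_trans (dist_to_le y Sz) _; rewrite [leRHS]addrC -[y - z](subrKA y').
exact: ler_normD.
Qed.

Lemma dist_to_lt y e : dist_to y < e -> exists2 z, S z & `|y - z| < e.
Proof.
move=> ye; apply: contrapT => h; suff : e <= dist_to y by rewrite leNgt ye.
apply: le_dist_to => z Sz; rewrite leNgt; apply/negP => yz; apply: h; by exists z.
Qed.

Lemma continuous_dist_to : continuous dist_to.
Proof.
move=> y; apply/(@cvgrPdist_le _ _ _ (nbhs y)) => /= e e0; apply/nbhs_ballP;
  exists e => // z.
rewrite -ball_normE /= => /ltW yz.
rewrite ler_norml; apply/andP; split; last exact: le_trans (dist_to_lip _ _) yz.
by rewrite lerNl opprB (le_trans (dist_to_lip _ _))// distrC.
Qed.
End distance.

Section torus.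
Context {R : realType}.
Variable f : R * R -> 'rV[R]_4.
Hypothesis pf : Defs.periodic f.

Lemma periodic_int (m n : int) x y : f (x + m%:~R, y + n%:~R) = f (x, y).
Proof.
have p1 (k : nat) a b : f (a + k%:R, b) = f (a, b).
  elim: k a => [|k IH] a; first by rewrite addr0.
  by rewrite -natr1 addrA; have [-> _] := pf (a + k%:R) b.
have p2 (k : nat) a b : f (a, b + k%:R) = f (a, b).
  elim: k b => [|k IH] b; first by rewrite addr0.
  by rewrite -natr1 addrA; have [_ ->] := pf a (b + k%:R).
have q1 (k : int) a b : f (a + k%:~R, b) = f (a, b).
  case: k => k; first exact: p1.
  by rewrite NegzE -{2}(subrK (k.+1%:R) a) p1 mulrNz.
have q2 (k : int) a b : f (a, b + k%:~R) = f (a, b).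
  case: k => k; first exact: p2.
  by rewrite NegzE -{2}(subrK (k.+1%:R) b) p2 mulrNz.
by rewrite q1 q2.
Qed.

Hypothesis cf : continuous f.

(** The lower density bound needs a base point in the interior of the
fundamental square, whereas a point found by the intermediate value theorem may
lie anywhere in the plane: it is translated to the square and then moved
slightly inside. *)
Lemma open_square_dense q (eta : R) : 0 < eta -> exists q' : R * R,
  [/\ 0 < q'.1 < 1, 0 < q'.2 < 1 & `|f q' - f q| < eta].
Proof.
move=> eta0; case: q => x y.
pose x0 := x - (Num.floor x)%:~R; pose y0 := y - (Num.floor y)%:~R.
have fE : f (x, y) = f (x0, y0).
  by rewrite -(periodic_int (Num.floor x) (Num.floor y) x0 y0) !subrK.
have frac (z : R) : 0 <= z - (Num.floor z)%:~R < 1.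
  have := floor_itv z; rewrite intrD => /andP[? ?]; apply/andP; split; lra.
have /andP[x1 x2] := frac x; have /andP[y1 y2] := frac y.
have /cvgrPdist_lt /(_ eta eta0) /nbhs_ballP[d /= d0 dP] := @cf (x0, y0).
pose h := Num.min (d / 2) (Num.min ((1 - x0) / 2) ((1 - y0) / 2)).
have [hd [hx hy]] : h <= d / 2 /\ h <= (1 - x0) / 2 /\ h <= (1 - y0) / 2.
  by rewrite /h !ge_min !lexx !orbT.
have h0 : 0 < h by rewrite !lt_min !divr_gt0// subr_gt0.
exists (x0 + h, y0 + h); rewrite /x0 /y0 in hx hy h0 *; split=> /=.
- by apply/andP; split; lra.
- by apply/andP; split; lra.
rewrite fE distrC; apply: dP; split => /=;
  rewrite /ball/= opprD addrA subrr sub0r normrN gtr0_norm//; lra.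
Qed.

(** The torus is connected; its universal cover being the plane, a segment is
a path between two points. *)
Lemma intermediate_value (u : 'rV[R]_4 -> R) p p' v : continuous u ->
  u (f p) <= v -> v <= u (f p') -> exists q, u (f q) = v.
Proof.
move=> cu pv vp'.
pose g (s : R) := u (f (p + s *: (p' - p))).
have cg : continuous g.
  move=> s; apply: (@continuous_comp _ _ _ (fun s : R => f (p + s *: (p' - p))) u);
    last exact: cu.
  apply: (@continuous_comp _ _ _ (fun s : R => p + s *: (p' - p)) f); last exact: cf.
  by apply: cvgD; [exact: cvg_cst|apply: cvgZr_tmp; exact: cvg_id].
have [||s _ gs] := @IVT _ g 0 1 v (ltW ltr01).
- exact: continuous_subspaceT.
- rewrite /g scale0r addr0 scale1r addrC subrK.
  by rewrite ge_min le_max pv vp' orbT.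
by exists (p + s *: (p' - p)).
Qed.
End torus.

(** * Convergence of the flow to the support *)

Section convergence.
Context {R : realType}.
Variables (T : R) (F : R -> R * R -> 'rV[R]_4).
Variable V : {measure set (borel_pair R) -> \bar R}.
Hypothesis flow : miwf T F.
Hypothesis varV : varifold V.
Hypothesis limV : forall Phi, Cc_grass2 Phi ->
  induced_varifold (F t) Phi @[t --> T^'-] --> \int[V]_(z in grass2 R) Phi z.

Lemma flow_immersion t : 0 < t < T -> immersionS3 (F t).
Proof.
move=> /andP[t0 tT]; have [_ _ H _] := flow.
by have [] := H t; first by rewrite ltW.
Qed.

Lemma near_flow_time s : s < T -> \forall t \near T^'-, s < t < T.
Proof.
move=> sT; near=> t; apply/andP; split.
  by near: t; exact: nbhs_left_gt.
by near: t; exact: nbhs_left_lt.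
Unshelve. all: by end_near. Qed.

Lemma flow_time_gt0 : 0 < T. Proof. by have [] := flow. Qed.

Lemma flow_norm_le1 t p : 0 < t < T -> `|F t p| <= 1.
Proof.
move=> tT; have [_ _ /(_ p) <- _] := flow_immersion tT.
exact: norm_le_enorm.
Qed.

Lemma intmu_gt0_ex f (phi : 'rV[R]_4 -> R) : immersionS3 f ->
  0 < intmu f (fun p => phi (f p)) -> exists p, phi (f p) != 0.
Proof.
move=> immf I0; apply: contrapT => h; move: I0.
have -> : (fun p => phi (f p)) = (fun=> 0).
  apply/funext => p; apply/eqP/negPn/negP => hp; apply: h; by exists p.
rewrite intmuE//.
have -> : (fun p => 0 * area_element (partial 0 f) (partial 1 f) p) =
  (fun p => 0 * (fun=> 0) p).
  by apply/funext => p; rewrite !mul0r.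
rewrite square_integralZ; last exact: continuous_const.
by rewrite mul0r ltxx.
Qed.

Lemma spt_approximated x eps : spt V x -> 0 < eps ->
  \forall t \near T^'-, exists p, `|F t p - x| < eps.
Proof.
move=> sx eps0.
pose phi (y : 'rV[R]_4) := Num.max 0 (1 - `|y - x| / eps).
have cphi : continuous phi.
  apply: continuous_pos => y; apply: (@cvgB _ _ _ (nbhs y)); first exact: cvg_cst.
  apply: (@cvgMl _ _ (nbhs y)).
  apply: (@continuous_comp _ _ _ (fun y : 'rV[R]_4 => y - x) (fun v => `|v|));
    last exact: norm_continuous.
  by apply: (@cvgB _ _ _ (nbhs y)); [exact: cvg_id|exact: cvg_cst].
have phi_far y : eps <= `|y - x| -> phi y = 0.
  by move=> yx; apply/max_idPl; rewrite subr_le0 ler_pdivlMr// mul1r.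
have phi_supp y : `|x| + eps < `|y| -> phi y = 0.
  move=> yx; apply: phi_far; have := ler_normD (y - x) x; rewrite subrK; lra.
have phi01 y : 0 <= phi y <= 1.
  rewrite le_max lexx/= ge_max ler01/= lerBlDr lerDl.
  by rewrite divr_ge0// ltW.
have e20 : 0 < eps / 2 by rewrite divr_gt0.
have phi_ge y : ball x (eps / 2) y -> 2^-1 <= phi y.
  rewrite -ball_normE /= distrC => yx; rewrite le_max; apply/orP; right.
  have : `|y - x| / eps <= 2^-1 by rewrite ler_pdivrMr// mulrC; exact: ltW.
  lra.
have oB : open (ball x (eps / 2)) by exact: ball_open.
have Bx : ball x (eps / 2) x by exact: ballxx.
have half0 : 0 < 2^-1 :> R by rewrite invr_gt0.
have I0 := integral_cylinder_gt0 varV cphi phi_supp sx oB Bx half0 phi01 phi_ge.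
have lim := limV (cylinder_Cc_grass2 cphi phi_supp).
near=> t.
have tT : 0 < t < T by near: t; exact: near_flow_time flow_time_gt0.
have It : 0 < intmu (F t) (fun p => phi (F t p)).
  near: t; apply: (cvgr_gt _ lim); exact: I0.
have [p pF] := intmu_gt0_ex (flow_immersion tT) It; exists p.
by rewrite ltNge; apply: contra pF => /phi_far ->.
Unshelve. all: by end_near. Qed.

Lemma spt_norm_le x : spt V x -> `|x| <= 2.
Proof.
move=> sx; have near1 := spt_approximated sx ltr01.
have nearT := near_flow_time flow_time_gt0.
near T^'- => t.
have tT : 0 < t < T by near: t; exact: nearT.
have [p px] : exists p, `|F t p - x| < 1 by near: t; exact: near1.
have := flow_norm_le1 p tT.
have := ler_normD (x - F t p) (F t p); rewrite subrK distrC; lra.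
Unshelve. all: by end_near. Qed.

Lemma spt_compact : compact (spt V).
Proof.
apply: (@subclosed_compact _ _ [set y : 'rV[R]_4 | `|y| <= 2]).
- exact: spt_closed.
- exact: compact_norm_le.
exact: spt_norm_le.
Qed.

Lemma spt_near_flow eps : 0 < eps ->
  \forall t \near T^'-, forall x, spt V x -> exists p, `|F t p - x| < eps.
Proof.
move=> eps0; have e20 : 0 < eps / 2 by rewrite divr_gt0.
have := (compact_near_coveringP (spt V)).1 spt_compact.
move=> /(_ R (T^'-) (fun t x => exists p, `|F t p - x| < eps)); apply => x sx.
exists (ball x (eps / 2), [set t | exists p, `|F t p - x| < eps / 2]).
  split => /=; first exact: nbhsx_ballx.
  exact: (spt_approximated sx e20).
move=> [y t] /= [+ [p px]]; rewrite -ball_normE /= => xy; exists p.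
have := ler_normD (F t p - x) (x - y); rewrite subrKA; lra.
Qed.

Hypothesis V0 : V setT != 0%E.

(** The second half of the theorem.  The test function [phi] is at least 1 on
the points of norm at most [eps + 1] at distance at least [eps / 4] from the
support of [V], and vanishes at distance less than [eps / 8]; by weak convergence
its integral over the surface tends to 0. *)
Lemma flow_near_spt eps : 0 < eps ->
  \forall t \near T^'-, forall p, dist_to (spt V) (F t p) < eps.
Proof.
move=> eps0; have sV0 := spt_nonempty V0; have [x0 sx0] := sV0.
pose a := eps / 8; have a0 : 0 < a by rewrite divr_gt0.
pose d := dist_to (spt V); have cd : continuous d := continuous_dist_to sV0.
pose phi (y : 'rV[R]_4) := Num.max 0 (d y / a - 1) * Num.max 0 (eps + 2 - `|y|).
have cphi : continuous phi.
  have c1 : continuous (fun y => Num.max 0 (d y / a - 1)).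
    apply: continuous_pos => y; apply: (@cvgB _ _ _ (nbhs y)); last exact: cvg_cst.
    by apply: (@cvgMl _ _ (nbhs y)); exact: cd.
  have c2 : continuous (fun y : 'rV[R]_4 => Num.max 0 (eps + 2 - `|y|)).
    apply: continuous_pos => y; apply: (@cvgB _ _ _ (nbhs y)); first exact: cvg_cst.
    exact: norm_continuous.
  by move=> y; apply: (@cvgM _ _ (nbhs y)); [exact: c1|exact: c2].
have phi0 y : 0 <= phi y by rewrite mulr_ge0// le_max lexx.
have phi_supp y : eps + 2 < `|y| -> phi y = 0.
  move=> yM; rewrite /phi; have /max_idPl -> : eps + 2 - `|y| <= 0 by rewrite subr_le0 ltW.
  by rewrite mulr0.
pose K := [set y : 'rV[R]_4 | `|y| <= eps + 2] `&` d @^-1` [set r | a <= r].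
have cK : compact K.
  apply: compact_closedI; first exact: compact_norm_le.
  by apply: closed_comp => [y _|]; [exact: cd|exact: closed_ge].
have Kspt y : K y -> ~ spt V y.
  move=> [_ /= ay] sy; have := dist_to_le (S := spt V) y sy.
  rewrite subrr normr0 -/(d y); lra.
have phiK y : phi y != 0 -> K y.
  move=> py; split; rewrite /= leNgt; apply/negP => h; move/negP: py; apply; apply/eqP.
    exact: phi_supp.
  rewrite /phi; have /max_idPl -> : d y / a - 1 <= 0.
    by rewrite subr_le0 ler_pdivrMr// mul1r ltW.
  by rewrite mul0r.
have lim := limV (cylinder_Cc_grass2 cphi phi_supp).
rewrite (integral_cylinder_eq0 cphi cK Kspt phiK) in lim.
have T0 := flow_time_gt0; have T20 : 0 < T / 2 by rewrite divr_gt0.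
pose W := willmore (F (T / 2)).
(* [packing_bound] with a mass term at most 1 reads [n / 36 <= W / 2 + 1]; [n] is
   chosen to violate it. *)
have [n nW] : exists n : nat, 36 * (W / 2 + 1) < n%:R.
  by exists (Num.trunc (36 * (W / 2 + 1))).+1; exact: truncnS_gt.
(* [n] values with spacing [h] fit between [eps / 2] and [eps].  The values found
   below are exact only up to [h / 4], so that points differ by at least [h / 2]. *)
pose h := eps / (2 * n.+1%:R); pose r := h / 4.
have h0 : 0 < h by rewrite divr_gt0// mulr_gt0.
have r0 : 0 < r by rewrite divr_gt0.
near=> t.
have tT : T / 2 < t < T by near: t; apply: near_flow_time; lra.
have {}tT' : 0 < t < T by move/andP: tT => [? ?]; apply/andP; split; lra.
have immt := flow_immersion tT'.
have Wt : willmore (F t) <= W.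
  by move/andP: tT => [/ltW ? ?]; exact: (willmore_nonincreasing flow T20).
(* This makes the mass term [4 / r^2 * integral] at most 1. *)
have small : intmu (F t) (fun p => phi (F t p)) < r ^+ 2 / 4.
  by near: t; apply: (cvgr_lt _ lim); rewrite divr_gt0// exprn_gt0.
have [p' p'x] : exists p, `|F t p - x0| < eps / 2.
  by near: t; apply: spt_approximated; rewrite ?divr_gt0.
have dp' : d (F t p') <= eps / 2 by apply: le_trans (dist_to_le _ sx0) (ltW p'x).
move=> p; rewrite ltNge; apply/negP => dp.
have pert : Defs.periodic (F t) by have [] := immt.
have cFt := immersion_continuous immt.
pose v (k : 'I_n) : R := eps / 2 + k%:R * h.
have hn : eps / 2 + n%:R * h <= eps.
  have : n.+1%:R * h = eps / 2 by rewrite /h; field; rewrite nat1r pnatr_eq0.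
  by rewrite -natr1 mulrDl mul1r; lra.
have vk k : eps / 2 <= v k <= eps.
  apply/andP; split; first by rewrite lerDl mulr_ge0// ltW.
  apply: le_trans hn; rewrite lerD2l ler_wpM2r ?(ltW h0)//.
  by rewrite ler_nat ltnW.
have /choice[P PP] : forall k : 'I_n, exists q : R * R,
    [/\ 0 < q.1 < 1, 0 < q.2 < 1 & `|d (F t q) - v k| < h / 4].
  move=> k; have /andP[v1 v2] := vk k.
  have [q dq] := intermediate_value cFt cd (le_trans dp' v1) (le_trans v2 dp).
  have [q' [q1 q2 q'q]] := open_square_dense pert cFt q r0.
  exists q'; split => //; rewrite -dq ltr_norml; apply/andP; split.
    by rewrite ltrNl opprB (le_lt_trans (dist_to_lip sV0 _ _))// distrC.
  exact: le_lt_trans (dist_to_lip sV0 _ _) q'q.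
have sep k l : k != l -> 2 * r <= `|F t (P k) - F t (P l)|.
  move=> kl; wlog lt_kl : k l kl / (k < l)%N.
    move=> H; have [/H|lk|e] := ltngtP k l; first exact.
      by rewrite distrC; apply: H => //; rewrite eq_sym.
    by move/eqP: kl; case; exact: val_inj.
  have [_ _ +] := PP k; have [_ _ +] := PP l.
  rewrite !ltr_norml => /andP[l1 l2] /andP[k1 k2].
  have vkl : v l - v k >= h.
    rewrite /v opprD addrACA subrr add0r -mulrBl ler_peMl ?(ltW h0)//.
    by rewrite -natrB ?(ltnW lt_kl)// ler1n subn_gt0.
  have := dist_to_lip sV0 (F t (P l)) (F t (P k)); rewrite -/d distrC => dl.
  apply: le_trans dl; rewrite /r; lra.
have phi1 k y : `|y - F t (P k)| < r -> 1 <= phi y.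
  move=> yk; have [_ _] := PP k; have /andP[v1 _] := vk k.
  have hh : h <= eps / 2.
    rewrite /h invfM mulrA ler_pdivrMr// ler_peMr ?ler1n//.
    by rewrite divr_ge0// ltW.
  rewrite ltr_norml => /andP[k1 _].
  have dy : eps / 4 <= d y.
    have := dist_to_lip sV0 (F t (P k)) y; rewrite -/d distrC; rewrite /r in yk; lra.
  have y1 : `|y| <= eps + 1.
    have := ler_normD (y - F t (P k)) (F t (P k)); rewrite subrK.
    have := flow_norm_le1 (P k) tT'; rewrite /r in yk; lra.
  rewrite /phi -[1]mulr1; apply: ler_pM => //; rewrite le_max; apply/orP; right; last lra.
  rewrite lerBrDr ler_pdivlMr// /a; lra.
have Pin k : 0 < (P k).1 < 1 /\ 0 < (P k).2 < 1 by have [] := PP k.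
have := packing_bound immt r0 Pin sep cphi phi0 phi1.
have : 4 / r ^+ 2 * intmu (F t) (fun p => phi (F t p)) <= 1.
  rewrite mulrAC ler_pdivrMr ?exprn_gt0// mul1r; lra.
have : 36 * (n%:R / 36) = n%:R :> R by field.
lra.
Unshelve. all: by end_near. Qed.
End convergence.

Section hausdorff.
Context {R : realType}.
Implicit Types K L : set 'rV[R]_4.

Lemma hausdorff_dist_le K L (e : R) :
  (forall x, K x -> exists2 y, L y & enorm (x - y) <= e) ->
  (forall y, L y -> exists2 x, K x & enorm (x - y) <= e) ->
  (hausdorff_dist K L <= e%:E)%E.
Proof.
move=> KL LK; rewrite /hausdorff_dist ge_max; apply/andP; split;
  apply: ub_ereal_sup => _ [x Kx <-].
- have [y Ly xy] := KL x Kx; apply: (@le_trans _ _ (enorm (x - y))%:E).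
    by apply: ereal_inf_lbound; exists y.
  by rewrite lee_fin.
- have [y Ly xy] := LK x Kx; apply: (@le_trans _ _ (enorm (y - x))%:E).
    by apply: ereal_inf_lbound; exists y.
  by rewrite lee_fin.
Qed.

Lemma hausdorff_dist_ge0 K L : K !=set0 -> (0 <= hausdorff_dist K L)%E.
Proof.
move=> [x Kx]; rewrite /hausdorff_dist le_max; apply/orP; left.
apply: (@le_trans _ _ (ereal_inf [set (enorm (x - y))%:E | y in L])).
  by apply: le_ereal_inf_tmp => _ [y _ <-]; rewrite lee_fin sqrtr_ge0.
by apply: ereal_sup_ubound; exists x.
Qed.
End hausdorff.

Theorem corollary5p4 (R : realType) (T : R) (F : R -> R * R -> 'rV[R]_4)
    (flow : miwf T F) (maximal : Tmax (F 0) = T%:E)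
    (energy : willmore (F 0) <= 8 * pi)
    (c0 : R) (c0_gt0 : 0 < c0)
    (A0_ge : forall t p, 0 < t < T -> c0 <= sff0_sq (F t) p)
    (V : {measure set (borel_pair R) -> \bar R}) (varV : varifold V)
    (limV : forall Phi, Cc_grass2 Phi ->
      induced_varifold (F t) Phi @[t --> T^'-] -->
        \int[V]_(z in grass2 R) Phi z)
    (V_neq0 : V setT != 0%E) :
  hausdorff_dist (range (F t)) (spt V) @[t --> T^'-] --> 0%E.
Proof.
have bound e : 0 < e ->
    \forall t \near T^'-, (0 <= hausdorff_dist (range (F t)) (spt V) <= e%:E)%E.
  move=> e0; have e20 : 0 < e / 2 by rewrite divr_gt0.
  have near1 := flow_near_spt flow varV limV V_neq0 e20.
  have near2 := spt_near_flow flow varV limV e20.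
  apply: filterS2 near1 near2 => t Ft sptF.
  have enorm_le u : `|u| < e / 2 -> enorm u <= e.
    by move=> ue; apply: le_trans (enorm_le_norm u) _; lra.
  apply/andP; split; first by apply: hausdorff_dist_ge0; exists (F t 0); exists 0.
  apply: hausdorff_dist_le.
    move=> _ [p _ <-]; have [z sz pz] := dist_to_lt (spt_nonempty V_neq0) (Ft p).
    by exists z => //; exact: enorm_le.
  by move=> z /sptF[p pz]; exists (F t p); [exists p|exact: enorm_le].
apply/fine_cvgP; split.
  apply: filterS (bound 1 ltr01) => t /andP[h0 h1].
  by rewrite ge0_fin_numE// (le_lt_trans h1)// ltry.
apply/cvgrPdist_le => e e0; apply: filterS (bound e e0) => t /andP[h0 h1] /=.
rewrite sub0r normrN ger0_norm ?fine_ge0// -lee_fin fineK//.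
by rewrite ge0_fin_numE// (le_lt_trans h1)// ltry.
Qed.
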